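(* An étale groupoid $\mathcal G$ is strongly amenable at infinity if and only if its Stone–Čech fibrewise compactification $(\beta_r\mathcal G,r_\beta)$ is an amenable $\mathcal G$-space.
   Context: Conventions. Locally compact spaces are Hausdorff and second countable (except Stone–Čech type compactifications such as $\beta_r\mathcal G$). A locally compact groupoid $\mathcal G$ is a groupoid with a locally compact (Hausdorff, second countable) topology, continuous structure maps, and open range and source maps $r,s:\mathcal G\to\mathcal G^{(0)}=X$; $\mathcal G^x=r^{-1}(x)$. It is étale if $r$ is a local homeomorphism. A left $\mathcal G$-space $(Y,p)$ is a locally compact space $Y$ with a continuous map $p:Y\to X$ and a continuous map $(\gamma,y)\mapsto\gamma y$ from $\{(\gamma,y): s(\gamma)=p(y)\}$ to $Y$ with $p(\gamma y)=r(\gamma)$, $p(y)y=y$, $(\gamma_2\gamma_1)y=\gamma_2(\gamma_1y)$. $Y\rtimes\mathcal G=\{(y,\gamma):p(y)=r(\gamma)\}$ is the groupoid with unit space $Y$, $r(y,\gamma)=y$, $s(y,\gamma)=\gamma^{-1}y$, $(y,\gamma)(\gamma^{-1}y,\gamma_1)=(y,\gamma\gamma_1)$. A locally compact groupoid $\mathcal G$ (possibly only $\sigma$-compact, as $\beta_r\mathcal G\rtimes\mathcal G$) is amenable if there is a net $(m_i)$, $m_i=(m_i^x)_{x\in X}$ with $m_i^x$ a probability measure on $\mathcal G^x$, such that $x\mapsto\int f\,dm_i^x$ is continuous for every $f\in C_c(\mathcal G)$ and $\lim_i\|\gamma m_i^{s(\gamma)}-m_i^{r(\gamma)}\|_1=0$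 uniformly on compact subsets. A $\mathcal G$-space $Y$ is amenable if $Y\rtimes\mathcal G$ is amenable. $\mathcal G$ is strongly amenable at infinity if there is an amenable (second countable) left $\mathcal G$-space $(Y,p)$ with $p$ proper, surjective, and having a continuous section $X\to Y$. Let $C_0(\mathcal G,r)$ be the norm closure in $C_b(\mathcal G)$ of the functions whose support is contained in $r^{-1}(K)$ for some compact $K\subset X$. $\beta_r\mathcal G$ is the Gelfand spectrum of $C_0(\mathcal G,r)$; it contains $\mathcal G$ as a dense open subset, the embedding $f\mapsto f\circ r$ of $C_0(X)$ gives a proper continuous map $r_\beta:\beta_r\mathcal G\to X$ extending $r$, and for étale $\mathcal G$ the action of $\mathcal G$ on itself by left translation extends uniquely to a continuous action on $(\beta_r\mathcal G,r_\beta)$. *)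

(* Defs.v *)
From HB Require Import structures.
From mathcomp Require Import all_boot all_order all_algebra.
From mathcomp Require Import all_classical all_reals all_analysis.
From mathcomp Require Import complex.

Set Implicit Arguments.
Unset Strict Implicit.
Unset Printing Implicit Defensive.

Import Order.TTheory GRing.Theory Num.Theory.
Import numFieldNormedType.Exports.

Local Open Scope classical_set_scope.
Local Open Scope ring_scope.

(** * Groupoids and actions *)

(* The unit space is a separate type [X], embedded in [G] by [un].  The product
   is a total function, but nothing is assumed about [mul g h] (nor, below,
   about [act g y]) outside the composable pairs. *)
Record groupoid (G X : Type) := Groupoid {
  rg : G -> X;
  sc : G -> X;
  un : X -> G;
  inv : G -> G;
  mul : G -> G -> G;
  rg_un : forall x, rg (un x) = x;
  sc_un : forall x, sc (un x) = x;
  rg_inv : forall g, rg (inv g) = sc g;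
  sc_inv : forall g, sc (inv g) = rg g;
  rg_mul : forall g h, sc g = rg h -> rg (mul g h) = rg g;
  sc_mul : forall g h, sc g = rg h -> sc (mul g h) = sc h;
  mul1g : forall g, mul (un (rg g)) g = g;
  mulg1 : forall g, mul g (un (sc g)) = g;
  mulgV : forall g, mul g (inv g) = un (rg g);
  mulVg : forall g, mul (inv g) g = un (sc g);
  mulgA : forall g h k, sc g = rg h -> sc h = rg k ->
    mul g (mul h k) = mul (mul g h) k }.

Record action (G X : Type) (D : groupoid G X) (Y : Type) (p : Y -> X) :=
  Action {
  act : G -> Y -> Y;
  act_p : forall g y, sc D g = p y -> p (act g y) = rg D g;
  act1 : forall y, act (un D (p y)) y = y;
  actM : forall g h y, sc D g = rg D h -> sc D h = p y ->
    act (mul D g h) y = act g (act h y) }.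

Section Crossed.
Variables (G X Y : topologicalType) (D : groupoid G X) (p : Y -> X).
Variable a : action D p.

Definition crossed_set : set (Y * G) := [set yg | p yg.1 = rg D yg.2].

Local Notation C := (set_type crossed_set).

Definition crossed_rg (c : C) : Y := (val c).1.
Definition crossed_sc (c : C) : Y := act a (inv D (val c).2) (val c).1.

Lemma crossed_un_subproof y : (y, un D (p y)) \in crossed_set.
Proof. by apply/mem_set; rewrite /crossed_set /= rg_un. Qed.

Definition crossed_un (y : Y) : C := 
  @exist _ (fun u => u \in crossed_set) _ (crossed_un_subproof y).

Lemma crossed_inv_subproof (c : C) :
  (crossed_sc c, inv D (val c).2) \in crossed_set.
Proof.
case: c => -[y g] /= yg; have /= pyg := set_mem yg; apply/mem_set.
by rewrite /crossed_set /crossed_sc /= act_p ?rg_inv// sc_inv.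
Qed.

Definition crossed_inv (c : C) : C := 
  @exist _ (fun u => u \in crossed_set) _ (crossed_inv_subproof c).

(* [insubd c v] is [v] when [v] lies in [crossed_set], which is the case when
   [c] and [d] are composable, and [c] otherwise. *)
Definition crossed_mul (c d : C) : C :=
  insubd c ((val c).1, mul D (val c).2 (val d).2).

Lemma crossedP (c : C) : p (val c).1 = rg D (val c).2.
Proof. by case: c => c cC; exact: (set_mem cC). Qed.

Lemma crossed_scP (c : C) : p (crossed_sc c) = sc D (val c).2.
Proof. by rewrite /crossed_sc act_p ?rg_inv// sc_inv crossedP. Qed.

Lemma crossed_comp (c d : C) :
  crossed_sc c = crossed_rg d -> sc D (val c).2 = rg D (val d).2.
Proof. by move=> cd; rewrite -crossed_scP cd crossedP. Qed.

Lemma val_crossed_mul (c d : C) : sc D (val c).2 = rg D (val d).2 ->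
  val (crossed_mul c d) = ((val c).1, mul D (val c).2 (val d).2).
Proof.
move=> cd; rewrite /crossed_mul val_insubd ifT//; apply/mem_set.
by rewrite /crossed_set /= rg_mul// crossedP.
Qed.

Lemma invgK g : inv D (inv D g) = g.
Proof.
rewrite -[LHS](mulg1 D) sc_inv rg_inv -(mulVg D) mulgA ?sc_inv ?rg_inv//.
by rewrite (mulVg D (inv D g)) sc_inv mul1g.
Qed.

Lemma inv_un x : inv D (un D x) = un D x.
Proof.
have := mul1g D (inv D (un D x)).
by rewrite rg_inv sc_un => <-; rewrite mulgV rg_un.
Qed.

Lemma actK g y : sc D g = p y -> act a (inv D g) (act a g y) = y.
Proof. by move=> gy; rewrite -actM ?sc_inv// mulVg gy act1. Qed.

Lemma actKV g y : rg D g = p y -> act a g (act a (inv D g) y) = y.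
Proof. by move=> gy; rewrite -{1}(invgK g) actK// sc_inv. Qed.

Lemma crossed_rg_un y : crossed_rg (crossed_un y) = y.
Proof. by []. Qed.

Lemma crossed_sc_un y : crossed_sc (crossed_un y) = y.
Proof. by rewrite /crossed_sc /= inv_un act1. Qed.

Lemma crossed_rg_inv c : crossed_rg (crossed_inv c) = crossed_sc c.
Proof. by []. Qed.

Lemma crossed_sc_inv c : crossed_sc (crossed_inv c) = crossed_rg c.
Proof. by rewrite /crossed_sc /= invgK actKV// crossedP. Qed.

Lemma crossed_rg_mul c d :
  crossed_sc c = crossed_rg d -> crossed_rg (crossed_mul c d) = crossed_rg c.
Proof. by move=> /crossed_comp cd; rewrite /crossed_rg val_crossed_mul. Qed.

Lemma crossed_sc_mul c d :
  crossed_sc c = crossed_rg d -> crossed_sc (crossed_mul c d) = crossed_sc d.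
Proof.
move=> /[dup] /crossed_comp cd e; rewrite /crossed_sc val_crossed_mul//=.
have -> : (val c).1 = act a (mul D (val c).2 (val d).2) (crossed_sc d).
  rewrite actM ?crossed_scP// actKV ?crossedP//.
  by rewrite -/(crossed_rg d) -e actKV// crossedP.
by rewrite actK// sc_mul// crossed_scP.
Qed.

Lemma crossed_mul1g c : crossed_mul (crossed_un (crossed_rg c)) c = c.
Proof.
apply: val_inj; rewrite val_crossed_mul /=; last by rewrite sc_un crossedP.
by rewrite crossedP mul1g -surjective_pairing.
Qed.

Lemma crossed_mulg1 c : crossed_mul c (crossed_un (crossed_sc c)) = c.
Proof.
apply: val_inj; rewrite val_crossed_mul /=; last by rewrite rg_un crossed_scP.
by rewrite crossed_scP mulg1 -surjective_pairing.
Qed.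

Lemma crossed_mulgV c :
  crossed_mul c (crossed_inv c) = crossed_un (crossed_rg c).
Proof.
by apply: val_inj; rewrite val_crossed_mul /= ?rg_inv// mulgV -crossedP.
Qed.

Lemma crossed_mulVg c :
  crossed_mul (crossed_inv c) c = crossed_un (crossed_sc c).
Proof.
by apply: val_inj; rewrite val_crossed_mul /= ?sc_inv// mulVg -crossed_scP.
Qed.

Lemma crossed_mulA c d e :
    crossed_sc c = crossed_rg d -> crossed_sc d = crossed_rg e ->
  crossed_mul c (crossed_mul d e) = crossed_mul (crossed_mul c d) e.
Proof.
move=> /crossed_comp cd /crossed_comp de.
have cdE := val_crossed_mul cd; have deE := val_crossed_mul de.
apply: val_inj; rewrite !val_crossed_mul ?cdE ?deE /= ?sc_mul ?rg_mul//.
by rewrite mulgA.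
Qed.

Definition crossed : groupoid C Y :=
  Groupoid crossed_rg_un crossed_sc_un crossed_rg_inv crossed_sc_inv
    crossed_rg_mul crossed_sc_mul crossed_mul1g crossed_mulg1
    crossed_mulgV crossed_mulVg crossed_mulA.

End Crossed.

(** * Topological conditions *)

Definition lc_groupoid (G X : topologicalType) (D : groupoid G X) : Prop :=
  [/\ [/\ hausdorff_space G, locally_compact [set: G] & @second_countable G],
      [/\ continuous (rg D), continuous (sc D), continuous (un D) &
          continuous (inv D)],
      {within [set gh : G * G | sc D gh.1 = rg D gh.2],
        continuous (fun gh => mul D gh.1 gh.2)},
      forall U : set G, open U -> open (rg D @` U) &
      forall U : set G, open U -> open (sc D @` U)].

Definition local_homeomorphism (T U : topologicalType) (f : T -> U) : Prop :=
  forall x, exists V : set T,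
    [/\ open_nbhs x V, {in V &, injective f}, {within V, continuous f} &
        forall W, open W -> W `<=` V -> open (f @` W)].

Definition etale (G X : topologicalType) (D : groupoid G X) : Prop :=
  local_homeomorphism (rg D).

(* Second countability of [Y] is not included. *)
Definition lc_gspace (G X Y : topologicalType) (D : groupoid G X)
    (p : Y -> X) (a : action D p) : Prop :=
  [/\ hausdorff_space Y, locally_compact [set: Y], continuous p &
      {within [set gy : G * Y | sc D gy.1 = p gy.2],
        continuous (fun gy => act a gy.1 gy.2)}].

Definition proper_map (T U : topologicalType) (f : T -> U) : Prop :=
  forall K, compact K -> compact (f @^-1` K).

(** * Amenability *)

(* The Borel sigma-algebra of [T]; measurable types have to be pointed, and [t]
   is used as the point. *)
Definition pointed_at (T : Type) (t : T) : Type := T.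
HB.instance Definition _ (T : choiceType) (t : T) := Choice.on (pointed_at t).
HB.instance Definition _ (T : choiceType) (t : T) :=
  isPointed.Build (pointed_at t) t.

Definition borel (T : topologicalType) (t : T) :=
  g_sigma_algebraType (@open T : set (set (pointed_at t))).

Definition total_variation_dist (R : realType) (T : topologicalType)
    (mu nu : set T -> \bar R) : \bar R :=
  ereal_sup [set v | exists n (A : 'I_n -> set T),
    [/\ forall k, <<s (@open T) >> (A k), trivIset setT A &
        v = (\sum_(k < n) `|mu (A k) - nu (A k)|)%E]].

(* The image of a measure, concentrated on the fibre of [rg D] over [sc D g],
   under left translation by [g]. *)
Definition translate (R : realType) (G X : topologicalType) (D : groupoid G X)
    (g : G) (mu : set G -> \bar R) : set G -> \bar R :=
  fun A => mu [set h | rg D h = sc D g /\ A (mul D g h)].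

Definition directed (I : Type) (le : I -> I -> Prop) : Prop :=
  [/\ inhabited I, forall i, le i i,
      forall i j k, le i j -> le j k -> le i k &
      forall i j, exists k, le i k /\ le j k].

(* A probability measure on the fibre of [rg D] over [x] is encoded as a Borel
   probability measure on [G] giving mass 1 to this (closed) fibre.  Borel
   probability measures on a second countable locally compact space are Radon;
   this covers the fibres of a second countable groupoid [D], and those of
   [crossed a] for any [D]-space [Y], since the fibre of the latter over [y] is
   homeomorphic to the fibre of [D] over [p y].
   Complex test functions are linear combinations of real ones. *)
Definition amenable (R : realType) (G X : topologicalType) (D : groupoid G X)
    : Prop :=
  exists (I : Type) (le : I -> I -> Prop)
         (m : I -> forall x : X, probability (borel (un D x)) R),
    [/\ directed le,
        forall i x, m i x (rg D @^-1` [set x]) = 1%E,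
        forall i (f : G -> R), continuous f ->
          compact (closure [set g | f g != 0]) ->
          continuous (fun x => Rintegral (m i x) setT f) &
        forall (K : set G) (e : R), compact K -> 0 < e ->
          exists i0, forall i, le i0 i -> forall g, K g ->
            (total_variation_dist (translate D g (m i (sc D g)))
               (m i (rg D g)) <= e%:E)%E].

Definition amenable_gspace (R : realType) (G X Y : topologicalType)
    (D : groupoid G X) (p : Y -> X) (a : action D p) : Prop :=
  lc_gspace a /\ amenable R (crossed a).

Definition strongly_amenable_at_infinity (R : realType)
    (G X : topologicalType) (D : groupoid G X) : Prop :=
  exists (Y : topologicalType) (p : Y -> X) (a : action D p),
    [/\ amenable_gspace R a, @second_countable Y, proper_map p,
        (forall x, exists y, p y = x) &
        exists q : X -> Y, continuous q /\ forall x, p (q x) = x].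

(** * The fibrewise Stone-Cech compactification *)

Definition bounded_continuous (R : realType) (T : topologicalType)
    (f : T -> R[i]^o) : Prop :=
  continuous f /\ exists M : R, forall x, `|f x| <= M%:C%C.

Definition C0 (R : realType) (T : topologicalType) : set (T -> R[i]^o) :=
  [set f | continuous f /\ forall e : R, 0 < e ->
     exists2 K, compact K & forall x, ~ K x -> `|f x| <= e%:C%C].

Definition C0r (R : realType) (G X : topologicalType) (D : groupoid G X) :
    set (G -> R[i]^o) :=
  [set f | bounded_continuous f /\ forall e : R, 0 < e ->
     exists (h : G -> R[i]^o) (K : set X),
       [/\ bounded_continuous h, compact K,
           closure [set g | h g != 0] `<=` rg D @^-1` K &
           forall g, `|f g - h g| <= e%:C%C]].

Arguments C0r R {G X} D.

(* The Gelfand spectrum of a subalgebra [A] of the algebra of functions on [T]: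
   the nonzero multiplicative linear functionals on [A], with the topology of
   pointwise convergence on [A]. *)
Definition gelfand (R : realType) (T : choiceType) (A : set (T -> R[i]^o)) :
    set {ptws A -> R[i]^o} :=
  [set phi | [/\ exists f, phi f != 0,
     forall f g h : A, val h = (fun x => val f x + val g x) ->
       phi h = phi f + phi g,
     forall (c : R[i]) (f h : A), val h = (fun x => c * val f x) ->
       phi h = c * phi f &
     forall f g h : A, val h = (fun x => val f x * val g x) ->
       phi h = phi f * phi g]].

Arguments gelfand {R T} A _.

Definition beta (R : realType) (G X : topologicalType) (D : groupoid G X) :=
  gelfand (C0r R D).

Arguments beta R {G X} D.

(* [phi] is the image of [g] under the embedding of [G] in [beta R D]. *)
Definition beta_at (R : realType) (G X : topologicalType) (D : groupoid G X)
    (g : G) (phi : beta R D) : Prop :=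
  forall f : C0r R D, val phi f = val f g.

(* The map dual to the embedding [f |-> f \o rg D] of [C0 X] in [C0r R D]. *)
Definition beta_rg (R : realType) (G X : topologicalType) (D : groupoid G X)
    (p : beta R D -> X) : Prop :=
  forall (f : X -> R[i]^o) (h : C0r R D) (phi : beta R D), C0 f ->
    val h = f \o rg D -> val phi h = f (p phi).

Definition extends_translation (R : realType) (G X : topologicalType)
    (D : groupoid G X) (p : beta R D -> X) (a : action D p) : Prop :=
  forall g h (phi : beta R D), sc D g = rg D h ->
    beta_at h phi -> beta_at (mul D g h) (act a g phi).

(* [beta_rg] determines [p], because [C0 X] separates the points of [X]; a
   continuous action extending left translation is determined on composable
   pairs, because [G] is dense in [beta R D]. *)
Definition beta_amenable (R : realType) (G X : topologicalType)
    (D : groupoid G X) : Prop :=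
  exists (p : beta R D -> X) (a : action D p),
    [/\ beta_rg p, extends_translation a & amenable_gspace R a].

(* Main.v *)
(** For an etale groupoid the fibres of [Y x| G] are discrete, so an approximate
    invariant mean on a [G]-space [Y] with proper anchor is the same thing as a
    family of continuous densities [w : Y x| G -> [0, 1]] of sum 1 on every
    fibre, with [\sum_h |w (g^-1 y, g^-1 h) - w (y, h)|] small uniformly for [g]
    in a compact subset of [G] (predicate [reiter]).  Such densities pull back
    along equivariant maps.

    If [Y] is a strongly amenable [G]-space with section [q], the equivariant map
    [g |-> g q(s(g))] extends to the fibrewise Stone-Cech compactification, and
    the densities pull back to it.

    Conversely, only countably many densities [w_n] on [beta] are needed.  On an
    open bisection [O_k] of a countable cover, [w_n] is a function of the point of
    [beta] alone, and the translation by an element of [O_k] turns a function on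
    [beta] into another one.  The countable family generated by the former under
    the latter operations therefore determines a second countable quotient of
    [beta] to which the action and all [w_n] descend; the image of the unit space
    is the required section. *)

From HB Require Import structures.
From mathcomp Require Import all_boot all_order all_algebra.
From mathcomp Require Import all_classical all_reals all_analysis.
From mathcomp Require Import measurable_realfun complex.
From mathcomp Require Import ring lra.
Require Import Defs.

Set Implicit Arguments.
Unset Strict Implicit.
Unset Printing Implicit Defensive.

Import Order.TTheory GRing.Theory Num.Theory.
Import numFieldNormedType.Exports.

Local Open Scope classical_set_scope.
Local Open Scope ring_scope.

(** * Topological preliminaries *)

(** Characters are handled through filters on [G]: the sublevel sets of suitable nonnegative
    functions generate a filter along which every real function of [C0r] tends to its value under
    the character. Identities on [beta R D] then follow from identities on [G] by passage to the
    limit, and new characters are produced as limits. Most operations make sense only on composable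
    pairs, over the range of an open set where [rg D] is injective. Multiplying by a cutoff on the
    unit space turns the functions they define there into elements of [C0r]. Properness of the
    anchor makes means yield densities: the pairs whose arrow lies in a compact set form a compact
    subset of the crossed product, so a cutoff on [G] lifts to an admissible test function, and a
    single atom can be read off as an integral. Countably many densities suffice because one density
    serves a given compact set and error, and the compact sets of [G] have a countable cofinal
    family. *)

Lemma compact_ind (T : topologicalType) (K : set T) (P : set T -> Prop) :
  compact K -> P set0 -> (forall A B, A `<=` B -> P B -> P A) ->
  (forall A B, P A -> P B -> P (A `|` B)) ->
  (forall x, K x -> exists2 U, nbhs x U & P U) -> P K.
Proof.
move=> cK P0 PS PU Pnb; apply: contrapT => nPK.
(* If [P K] fails, the sets whose complement in [K] has [P] form a proper filter; at a cluster
   point, a neighbourhood with [P] puts its complement into the filter. *)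
pose F := [set A : set T | P (K `\` A)].
have FF : ProperFilter F.
  apply: Build_ProperFilter_ex.
    move=> A FA; apply: contrapT => nA; apply: nPK.
    apply: PS FA => x Kx; split=> // Ax; apply: nA; by exists x.
  split.
  - by rewrite /F /= setDT.
  - by move=> A B FA FB; rewrite /F /= setDIr; exact: PU.
  - by move=> A B AB; apply: PS => x [Kx nB]; split=> // /AB.
have FK : F K by rewrite /F /= setDv.
have [x [Kx clx]] := cK F FF FK.
have [U Ux PUU] := Pnb x Kx.
have FU : F (~` U) by rewrite /F /=; apply: PS PUU => y [_ /contrapT].
by have [y [? ?]] := clx _ _ FU Ux.
Qed.

Lemma lc_nbhs (T : topologicalType) (x : T) : locally_compact [set: T] ->
  exists2 W, nbhs x W & compact W /\ closed W.
Proof.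
move=> /(_ x I) [U]; rewrite /within /= => xU cU.
by exists U => //; apply: filterS xU => y; exact.
Qed.

Section urysohn_lc.
Context {R : realType} {T : topologicalType}.
Hypothesis hT : hausdorff_space T.
Hypothesis lT : locally_compact [set: T].

(** A single point is handled by complete regularity; [compact_ind] on [K] then glues finitely many
    functions by their maximum. *)
Lemma urysohn_lc (K U : set T) : compact K -> open U -> K `<=` U ->
  exists (e : T -> R) (N : set T), [/\ continuous e,
    forall x, 0 <= e x <= 1, open N /\ K `<=` N, forall x, N x -> e x = 1 &
    compact (closure [set x | e x != 0]) /\ closure [set x | e x != 0] `<=` U].
Proof.
move=> cK oU KU.
apply: (@compact_ind _ _ (fun K => exists (e : T -> R) (N : set T),
   [/\ continuous e,
    forall x, 0 <= e x <= 1, open N /\ K `<=` N, forall x, N x -> e x = 1 &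
    compact (closure [set x | e x != 0]) /\ closure [set x | e x != 0] `<=` U])
    cK).
- exists (cst 0), set0; split => //.
  + exact: cst_continuous.
  + by move=> x; rewrite lexx ler01.
  + by split; [exact: open0|].
  + rewrite [X in closure X](_ : _ = set0) ?closure0; last first.
      by rewrite -subset0 => x /=; rewrite eqxx.
    by split=> //; exact: compact0.
- move=> A B AB [e [N [? ? [? ?] ? ?]]]; exists e, N; split => //.
  by split=> //; exact: subset_trans AB _.
- move=> A B [e [N [ce e01 [oN AN] e1 [cse seU]]]].
  move=> [f [M [cf f01 [oM BM] f1 [csf sfU]]]].
  have sup : closure [set x | Num.max (e x) (f x) != 0] `<=`
      closure [set x | e x != 0] `|` closure [set x | f x != 0].
    rewrite -closureU; apply: closureS => x /=.
    apply: contraPP => /not_orP [/negP] ; rewrite negbK => /eqP -> /negP.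
    by rewrite negbK => /eqP ->; rewrite maxxx eqxx.
  exists (fun x => Num.max (e x) (f x)), (N `|` M); split.
  + by move=> x; apply: (@continuous_max R T e f); [exact: ce|exact: cf].
  + move=> x; have /andP[? ?] := e01 x; have /andP[? ?] := f01 x.
    by rewrite le_max ge_max; apply/andP; split; [apply/orP; left|apply/andP].
  + by split; [exact: openU|move=> x [/AN|/BM]; [left|right]].
  + move=> x [/e1|/f1] ->; have /andP[? ?] := e01 x; have /andP[? ?] := f01 x.
      by apply/max_idPl.
    exact/max_idPr.
  + split; last by move=> x /sup [/seU|/sfU].
    apply: subclosed_compact sup; first exact: closed_closure.
    exact: compactU.
move=> x Kx; have [W xW [cW clW]] := lc_nbhs x lT.
have xO : (U `&` W°) x by split; [exact: KU|exact: xW].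
have oO : open (U `&` W°) by apply: openI => //; exact: open_interior.
have := @locally_compact_completely_regular T R lT hT x (~` (U `&` W°))
  (open_closedC oO) (fun h => h xO).
move=> /(@uniform_separatorP _ R) [f [cf f01 fx fB]].
(* [g] is 1 where [f <= 1/4] and 0 where [f >= 1/2]; even its closed support then lies in
   [f <= 1/2], away from the points where [f] is 1. *)
pose g t := Num.min 1 (Num.max 0 (2 - 4 * f t)).
have cg : continuous g.
  move=> t; apply: (@continuous_min R T (cst 1)
    (fun s => Num.max 0 (2 - 4 * f s))); first exact: cst_continuous.
  apply: (@continuous_max R T (cst 0) (fun s => 2 - 4 * f s)).
    exact: cst_continuous.
  apply: cvgB; first exact: cvg_cst.
  by apply: cvgM; [exact: cvg_cst|exact: cf].
have op : open [set t | f t < 1/4].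
  by rewrite (_ : [set _ | _] = f @^-1` [set r | r < 1/4])//; apply: open_comp;
   [move=> ? _; exact: cf|exact: open_lt].
exists [set t | f t < 1/4].
  apply: open_nbhs_nbhs; split => //=.
  have -> : f x = 0 by apply: fx; exists x.
  lra.
exists g, [set t | f t < 1/4]; split; [exact: cg| |by split| |].
- by move=> t; rewrite /g le_min ge_min le_max !lexx ler01.
- by move=> t /= ft; rewrite /g; apply/min_idPl; rewrite le_max; apply/orP; right; lra.
have sub : closure [set t | g t != 0] `<=` U `&` W.
  have cl : closed [set t | f t <= 1/2].
    by rewrite (_ : [set _ | _] = f @^-1` [set r | r <= 1/2])//;
      apply: preimage_closed; [move=> ? _; exact: cf|exact: closed_le].
  apply: subset_trans (_ : [set t | f t <= 1/2] `<=` _); last first.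
    move=> t /= ft; have [[? /interior_subset ?]//|nt] := pselect ((U `&` W°) t).
    have : f t = 1 by apply: fB; exists t.
    by move: ft => /[swap] ->; lra.
  rewrite closureE => t; apply; split => // s /=; apply: contraNT.
  rewrite -ltNge => fs; rewrite /g; apply/eqP.
  have -> : Num.max 0 (2 - 4 * f s) = 0 by apply/max_idPl; lra.
  by apply/min_idPr.
split; last by move=> t /sub [].
apply: subclosed_compact cW _; first exact: closed_closure.
by move=> t /sub [].
Qed.

End urysohn_lc.

(** [mul], [act] and the densities are continuous only on composable pairs; this lets both arguments
    move along a filter that eventually stays among such pairs. *)
Lemma within_cvg2 (I : Type) (F : set_system I) (T U V : topologicalType)
    (A : set (T * U)) (f : T -> U -> V) (u : I -> T) (v : I -> U) t0 u0 :
  Filter F -> {within A, continuous (fun tu => f tu.1 tu.2)} -> A (t0, u0) ->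
  u @ F --> t0 -> v @ F --> u0 -> (\forall i \near F, A (u i, v i)) ->
  (fun i => f (u i) (v i)) @ F --> f t0 u0.
Proof.
move=> FF /subspace_continuousP cf A0 ut vu FA.
have uv : (fun i => (u i, v i)) @ F --> (t0, u0) by exact: cvg_pair.
move=> B /(cf _ A0); rewrite /nbhs /= /within /= => /uv /= FB.
by apply: filterS2 FA FB => i Ai; exact.
Qed.

Lemma lindelof (T : topologicalType) (I : Type) (i0 : I) (O : I -> set T) :
  @second_countable T -> (forall i, open (O i)) -> (forall x, exists i, O i x) ->
  exists c : nat -> I, forall x, exists n, O (c n) x.
Proof.
move=> [B cB [oB bB]] oO Ocov.
have /countable_injP [f finj] := cB.
(* To the basic open set numbered [n] is attached a member of the cover that contains it, if there
   is one, and otherwise [i0]. *)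
have /choice [c cP] : forall n, exists i, forall U, B U -> f U = n ->
    (exists j, U `<=` O j) -> U `<=` O i.
  move=> n; have [[U [BU fU [i Ui]]]|nU] :=
      pselect (exists U, [/\ B U, f U = n & exists i, U `<=` O i]).
    exists i => V BV fV _; suff -> : V = U by [].
    by apply: finj; rewrite ?inE// fU fV.
  by exists i0 => U BU fU iU; case: nU; exists U.
exists c => x; have [i Oix] := Ocov x.
have [U [BU Ux UO]] := bB x (O i) (open_nbhs_nbhs (conj (oO i) Oix)).
by exists (f U); apply: (cP _ U BU erefl) => //; exists i.
Qed.

(** * Discrete measures *)

Section esum_measure.
Context {R : realType} d (T : measurableType d) (w : T -> R).
Hypothesis w0 : forall t, 0 <= w t.
Hypothesis w1 : \esum_(t in [set: T]) (w t)%:E = 1%E.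

Definition esum_mass (A : set T) : \bar R := \esum_(t in A) (w t)%:E.

Local Lemma esum_mass0 : esum_mass set0 = 0%E.
Proof. exact: esum_set0. Qed.

Local Lemma esum_mass_ge0 A : (0 <= esum_mass A)%E.
Proof. by apply: esum_ge0 => t _; rewrite lee_fin. Qed.

Local Lemma esum_mass_sigma_additive : semi_sigma_additive esum_mass.
Proof.
move=> F _ tF _; rewrite /esum_mass.
rewrite nneseries_sum_bigcup//.
by apply: is_cvg_ereal_nneg_natsum => n _; exact: esum_mass_ge0.
Qed.

HB.instance Definition _ := isMeasure.Build _ T R esum_mass
  esum_mass0 esum_mass_ge0 esum_mass_sigma_additive.

HB.instance Definition _ := Measure_isProbability.Build _ _ _ esum_mass w1.

Definition esum_probability : probability T R := esum_mass.

End esum_measure.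

Lemma abs_esumB (R : realType) (T : choiceType) (S : set T) (f g : T -> R) :
  (forall t, 0 <= f t) -> (forall t, 0 <= g t) ->
  (\esum_(t in S) (f t)%:E \is a fin_num)%E ->
  (\esum_(t in S) (g t)%:E \is a fin_num)%E ->
  (`|\esum_(t in S) (f t)%:E - \esum_(t in S) (g t)%:E|
    <= \esum_(t in S) `|f t - g t|%:E)%E.
Proof.
move=> f0 g0 ff fg.
have le (u v : T -> R) : (forall t, 0 <= u t) -> (forall t, 0 <= v t) ->
    (\esum_(t in S) (u t)%:E <=
      \esum_(t in S) (v t)%:E + \esum_(t in S) `|u t - v t|%:E)%E.
  move=> u0 v0; rewrite -esumD; last 2 first.
  - by move=> t _; rewrite lee_fin.
  - by move=> t _; rewrite lee_fin.
  apply: le_esum => t _; rewrite -EFinD lee_fin -lerBlDl.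
  exact: ler_norm.
have := le f g f0 g0; have := le g f g0 f0.
rewrite [X in (_ <= _ + X)%E -> _](eq_esum (b := fun t => `|f t - g t|%:E));
  last by move=> t _; rewrite distrC.
have : (0 <= \esum_(t in S) `|f t - g t|%:E)%E.
  by apply: esum_ge0 => t _; rewrite lee_fin.
move: ff fg; case: (\esum_(t in S) (f t)%:E) => [a| |]// _.
case: (\esum_(t in S) (g t)%:E) => [b| |]// _.
case: (\esum_(t in S) `|f t - g t|%:E) => [s| |]//= _; last by move=> *; rewrite leey.
rewrite -!EFinD !lee_fin => ba ab.
by rewrite ler_norml; apply/andP; split; lra.
Qed.

Lemma measure_countable d (T : measurableType d) (R : realType)
    (mu : {measure set T -> \bar R}) (A : set T) :
  (forall t : T, measurable [set t]) -> countable A ->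
  mu A = \esum_(t in A) mu [set t].
Proof.
move=> m1 /countable_injP [f finj].
pose B n := A `&` f @^-1` [set n].
have BE n : B n = set0 \/ exists2 t, A t & B n = [set t].
  have [[t [At ft]]|nB] := pselect (exists t, B n t).
    right; exists t => //; apply/seteqP; split=> [s [As /= fs]|_ ->]; last by [].
    by apply: finj; rewrite ?inE// fs.
  by left; rewrite -subset0 => t Bt; apply: nB; exists t.
have AE : A = \bigcup_n B n.
  by apply/seteqP; split=> [t At|t [n _ []]//]; exists (f t).
have tB : trivIset setT B.
  by apply/trivIsetP => i j _ _ ij; rewrite -subset0 => t [[_ /= fi] [_ /= fj]];
    move: ij; rewrite -fi -fj eqxx.
rewrite [in RHS]AE nneseries_sum_bigcup// [in LHS]AE measure_semi_bigcup//.
- apply: eq_eseriesr => n _; have [->|[t At ->]] := BE n.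
    by rewrite measure0 esum_set0.
  by rewrite esum_set1.
- by move=> n; have [->|[t At ->]] := BE n.
- by rewrite -AE; rewrite AE; apply: bigcup_measurable => n _;
    have [->|[t At ->]] := BE n.
Qed.

Section Rintegral_points.
Context {R : realType} d (T : measurableType d) (P : probability T R).
Variables (f : T -> R) (M : R).
Hypothesis mf : measurable_fun setT f.
Hypothesis fM : forall t, `|f t| <= M.
Hypothesis m1 : forall t : T, measurable [set t].

Lemma bounded_integrable B : measurable B -> P.-integrable B (EFin \o f).
Proof.
move=> mB; apply: (@integrableS _ _ _ _ setT) => //.
apply: (@le_integrable _ _ _ _ _ _ _ (EFin \o cst M)) => //.
- exact/measurable_EFinP.
- move=> t _ /=; rewrite lee_fin; apply: le_trans (fM t) _.
  exact: ler_norm.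
- exact: finite_measure_integrable_cst.
Qed.

Lemma normr_Rintegral_le B : measurable B ->
  `|Rintegral P B f| <= M * fine (P B).
Proof.
move=> mB; have iB := bounded_integrable mB.
apply: le_trans (le_normr_Rintegral mB iB) _.
rewrite -Rintegral_cst//; apply: le_Rintegral => //.
- exact: integrable_norm.
- apply: (@integrableS _ _ _ _ setT) => //.
  exact: finite_measure_integrable_cst.
Qed.

(** Splits off finitely many atoms; [normr_Rintegral_le] bounds the remainder by the mass left
    over. *)
Lemma Rintegral_seqE (s : seq T) : uniq s ->
  Rintegral P setT f = \sum_(t <- s) f t * fine (P [set t]) +
    Rintegral P (~` [set` s]) f.
Proof.
elim: s => [_|t s ih /= /andP[ts us]].
  rewrite big_nil add0r; congr (Rintegral P _ f).
  by apply/seteqP; split.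
have ms : measurable [set` s].
  by apply: countable_measurable => //; exact/finite_set_countable/finite_seq.
rewrite big_cons ih// -addrA addrCA; congr (_ + _).
have -> : ~` [set` s] = [set t] `|` ~` [set` t :: s].
  apply/seteqP; split=> [u /= us'|u [->|/=]].
  - have [->|ut] := eqVneq u t; first by left.
    by right; rewrite /= inE (negbTE ut).
  - exact/negP.
  - by rewrite inE => /negP; rewrite negb_or => /andP[_ /negP].
rewrite Rintegral_setU//.
- congr (_ + _); rewrite -Rintegral_cst//.
  by apply: eq_Rintegral => u; rewrite inE => /= ->.
- apply: measurableC; apply: countable_measurable => //.
  exact/finite_set_countable/finite_seq.
- apply: bounded_integrable; apply: measurableU => //.
  apply: measurableC; apply: countable_measurable => //.
  exact/finite_set_countable/finite_seq.
- by apply/disj_setPS => u [/= ->]; rewrite inE eqxx.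
Qed.
End Rintegral_points.

(** * Etale groupoids *)

Lemma hausdorff_prod (T U : topologicalType) :
  hausdorff_space T -> hausdorff_space U -> hausdorff_space (T * U)%type.
Proof.
move=> hT hU [y g] [y' g'] cl; congr (_, _).
  apply: hT => A B Ay By'.
  have fA : nbhs (y, g) (fst @^-1` A) by exact: cvg_fst.
  have fB : nbhs (y', g') (fst @^-1` B) by exact: cvg_fst.
  by have [[z h] [/= Az Bz]] := cl _ _ fA fB; exists z.
apply: hU => A B Ag Bg'.
have sA : nbhs (y, g) (snd @^-1` A) by exact: cvg_snd.
have sB : nbhs (y', g') (snd @^-1` B) by exact: cvg_snd.
by have [[z h] [/= Az Bz]] := cl _ _ sA sB; exists h.
Qed.

Section subtype.
Context {T : topologicalType} (A : set T).

Lemma val_subtype_continuous : continuous (val : A -> T).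
Proof. exact: initial_continuous. Qed.

Lemma cvg_subtype (I : Type) (F : set_system I) (u : I -> A) (c : A) :
  Filter F -> (fun i => val (u i)) @ F --> val c -> u @ F --> c.
Proof.
move=> FF uc B [/= _ [[V oV <-] /= Vc VB]].
have FV : F (fun i => V (val (u i))) by exact: uc V (open_nbhs_nbhs (conj oV Vc)).
by apply: (@filterS _ F _ _ _ _ FV) => i Vi; exact: VB.
Qed.

Lemma compact_subtype (K : set T) :
  compact K -> K `<=` A -> compact (val @^-1` K : set A).
Proof.
move=> cK KA F FF FK.
have vF : (val @ F) K by [].
have [t [Kt ct]] := cK (val @ F) _ vF.
exists (exist _ t (mem_set (KA _ Kt))); split => // B C FB [/= _ [[V oV <-] /= Vc VC]].
have FvB : F (val @^-1` (val @` B)).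
  by apply: filterS FB => b Bb; exists b.
have [_ [[b Bb <-] Vb]] := ct _ _ FvB (open_nbhs_nbhs (conj oV Vc)).
by exists b; split => //; exact: VC.
Qed.

Lemma hausdorff_subtype : hausdorff_space T -> hausdorff_space A.
Proof.
move=> hT c d cd; apply: val_inj; apply: hT => B C Bc Cd.
have [b [Bb Cb]] := cd _ _ (val_subtype_continuous Bc) (val_subtype_continuous Cd).
by exists (val b).
Qed.

End subtype.

Section lc_groupoid_facts.
Context {G X : topologicalType} {D : groupoid G X} (hD : lc_groupoid D).

Lemma hausdorff_arrows : hausdorff_space G. Proof. by case: hD => -[]. Qed.
Lemma lc_arrows : locally_compact [set: G]. Proof. by case: hD => -[]. Qed.
Lemma second_countable_arrows : @second_countable G.
Proof. by case: hD => -[]. Qed.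
Lemma rg_continuous : continuous (rg D). Proof. by case: hD => _ []. Qed.
Lemma sc_continuous : continuous (sc D). Proof. by case: hD => _ []. Qed.
Lemma un_continuous : continuous (un D). Proof. by case: hD => _ []. Qed.
Lemma inv_continuous : continuous (inv D). Proof. by case: hD => _ []. Qed.
Lemma mul_continuous :
  {within [set gh : G * G | sc D gh.1 = rg D gh.2],
        continuous (fun gh => mul D gh.1 gh.2)}.
Proof. by case: hD. Qed.
Lemma rg_open (U : set G) : open U -> open (rg D @` U).
Proof. by case: hD => _ _ _ + _; exact. Qed.

Lemma hausdorff_units : hausdorff_space X.
Proof.
move=> x y xy; rewrite -(rg_un D x) -(rg_un D y); congr (rg D _).
apply: hausdorff_arrows => A B Ax By.
have [z [Az Bz]] := xy _ _ (@un_continuous x _ Ax) (@un_continuous y _ By).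
by exists (un D z).
Qed.

Lemma lc_units : locally_compact [set: X].
Proof.
move=> x _; have [W xW [cW clW]] := lc_nbhs (un D x) lc_arrows.
have cRW : compact (rg D @` W).
  apply: continuous_compact => //; apply: continuous_subspaceT.
  exact: rg_continuous.
exists (rg D @` W); last by split => //; apply: compact_closed => //;
  exact: hausdorff_units.
have : nbhs x (rg D @` W°).
  apply: open_nbhs_nbhs; split; first exact/rg_open/open_interior.
  by exists (un D x); [exact: xW|rewrite rg_un].
by apply: filterS => y [g /interior_subset Wg <-] _; exists g.
Qed.

Lemma second_countable_units : @second_countable X.
Proof.
have [B cB [oB bB]] := second_countable_arrows.
exists [set un D @^-1` U | U in B].
  exact: sub_countable (card_image_le _ _) cB.
split=> [_ [U /oB oU <-]|x A].
  by apply: open_comp => // y _; exact: un_continuous.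
rewrite -{1}(rg_un D x) => /(@rg_continuous (un D x)) /bB [U [BU Ux] UA].
exists (un D @^-1` U); first by split => //; exists U.
by move=> y /UA /=; rewrite rg_un.
Qed.

(** On the open set [q.2] the map [rg D] is injective, with inverse [q.1]. The map [q.1] is total so
    that no domain has to be carried along; its values off the range of [q.2] are arbitrary. *)
Definition local_section (q : (X -> G) * set G) :=
  [/\ open q.2, forall h, q.2 h -> q.1 (rg D h) = h &
      forall h, q.2 h -> {for rg D h, continuous q.1}].

Lemma etale_section (g : G) : etale D -> exists2 q, local_section q & q.2 g.
Proof.
move=> /(_ g) [V [[oV Vg] injV _ openV]].
pose s (x : X) : G := xget g [set h | V h /\ rg D h = x].
have sE h : V h -> s (rg D h) = h.
  move=> Vh; rewrite /s; case: xgetP => [k _ [Vk kh]|/(_ h) /not_andP[]//].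
  by apply: injV; rewrite ?inE.
exists (s, V) => //; split => //= h Vh B; rewrite sE// => hB.
have oW : open (V `&` B°) by apply: openI => //; exact: open_interior.
have : nbhs (rg D h) (rg D @` (V `&` B°)).
  apply: open_nbhs_nbhs; split; first by apply: openV => // k [].
  by exists h.
by apply: filterS => _ [k [Vk /interior_subset Bk] <-] /=; rewrite sE.
Qed.

Lemma etale_sections : etale D -> exists q : nat -> (X -> G) * set G,
  (forall n, local_section (q n)) /\ forall g, exists n, (q n).2 g.
Proof.
move=> hE; pose I := {q : (X -> G) * set G | local_section q}.
have s0 : local_section (un D, set0) by split => //; exact: open0.
have [c cP] := @lindelof G I (exist _ _ s0) (fun q => (sval q).2)
  second_countable_arrows (fun q => let: And3 o _ _ := svalP q in o)
  (fun g => let: ex_intro2 q qs qg := etale_section g hE in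
     ex_intro _ (exist _ q qs) qg).
by exists (fun n => sval (c n)); split => // n; exact: svalP (c n).
Qed.

(** An arrow of given range is determined by any local section containing it, and countably many
    sections cover [G]. *)
Lemma countable_fibre x : etale D -> countable [set g | rg D g = x].
Proof.
move=> /etale_sections [q [qs qc]].
have [f fP] := choice qc.
apply/countable_injP; exists f => g h; rewrite !inE => /= gx hx fgh.
have [_ sE _] := qs (f g).
by rewrite -[LHS]sE// gx -hx sE// fgh.
Qed.

End lc_groupoid_facts.

Arguments local_section {G X} D q.

(** * Densities and amenability *)

Lemma near_all_seq (I : eqType) (T : Type) (F : set_system T) (P : I -> T -> Prop)
    (s : seq I) : Filter F -> (forall i, i \in s -> \forall t \near F, P i t) ->
  \forall t \near F, forall i, i \in s -> P i t.
Proof.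
move=> FF; elim: s => [_|i s ih Ps]; first by near=> t.
have Pi := Ps i (mem_head _ _).
have {}ih := ih (fun j js => Ps j (mem_behead (s := i :: s) js)).
near=> t => j; rewrite inE => /orP[/eqP ->|]; first by near: t.
by apply: (near ih t).
Unshelve. all: by end_near. Qed.

(* The density [w y] on the fibre of [g] over [p y] stands for the measure
   [\sum_g w y g \d_(y, g)] on the fibre of the crossed product over [y]. *)
Definition reiter (R : realType) (G X Y : topologicalType) (D : groupoid G X)
    (p : Y -> X) (a : action D p) : Prop :=
  forall (L : set G) (e : R), compact L -> 0 < e -> exists w : Y -> G -> R,
    [/\ {within crossed_set D p, continuous (fun yg => w yg.1 yg.2)},
        forall y g, 0 <= w y g,
        forall y, \esum_(g in [set g | rg D g = p y]) (w y g)%:E = 1%E &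
        forall y g, L g -> rg D g = p y ->
          (\esum_(h in [set h | rg D h = rg D g])
            `|w (act a (inv D g) y) (mul D (inv D g) h) - w y h|%:E <= e%:E)%E].

Section crossed_facts.
Context {R : realType} {G X Y : topologicalType} {D : groupoid G X} {p : Y -> X}.
Variable a : action D p.
Local Notation C := (set_type (crossed_set D p)).
Local Notation H := (crossed a).

Definition crossed_pt (y : Y) (g : G) : C := insubd (crossed_un D p y) (y, g).

Lemma val_crossed_pt y g : rg D g = p y -> val (crossed_pt y g) = (y, g).
Proof. by move=> gy; rewrite val_insubd mem_set// /crossed_set /= gy. Qed.

Lemma crossed_ptK c : crossed_pt (val c).1 (val c).2 = c.
Proof.
by apply: val_inj; rewrite val_crossed_pt -?surjective_pairing ?crossedP.
Qed.

Lemma crossed_fibre_bij y :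
  set_bij [set g | rg D g = p y] [set c | crossed_rg c = y] (crossed_pt y).
Proof.
split.
- by move=> g /= gy; rewrite /crossed_rg val_crossed_pt.
- move=> g h; rewrite !inE /= => gy hy /(congr1 val).
  by rewrite !val_crossed_pt// => -[].
- move=> c /= cy; exists (val c).2; first by rewrite -cy -crossedP.
  by rewrite -cy crossed_ptK.
Qed.

Lemma esum_crossed_fibre y (F : C -> \bar R) :
  \esum_(c in [set c | crossed_rg c = y]) F c =
  \esum_(g in [set g | rg D g = p y]) F (crossed_pt y g).
Proof. exact/reindex_esum/crossed_fibre_bij. Qed.

Lemma mulKg (g h : G) : rg D g = rg D h ->
  mul D g (mul D (inv D g) h) = h.
Proof. by move=> gh; rewrite mulgA ?rg_inv ?sc_inv// mulgV gh mul1g. Qed.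

Lemma mulgK (g h : G) : sc D g = rg D h ->
  mul D (inv D g) (mul D g h) = h.
Proof. by move=> gh; rewrite mulgA ?sc_inv// mulVg gh mul1g. Qed.

End crossed_facts.

Section translate.
Context {R : realType} {G X : topologicalType} {D : groupoid G X}.

(** Reindexing along this bijection writes the mass that a translated discrete measure gives to [A]
    as a sum over the points of [A] in one fibre. *)
Lemma translate_bij (k : G) (A : set G) :
  set_bij [set h | A h /\ rg D h = rg D k]
    [set h | rg D h = sc D k /\ A (mul D k h)] (mul D (inv D k)).
Proof.
split.
- by move=> h /= [Ah hk]; rewrite rg_mul ?rg_inv ?sc_inv// mulKg.
- move=> h h'; rewrite !inE /= => -[_ hk] [_ h'k] e.
  by rewrite -(mulKg (esym hk)) e mulKg.
- move=> h /= [hk Ah]; exists (mul D k h); last by rewrite mulgK.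
  by rewrite rg_mul.
Qed.

End translate.

Section reiter_amenable.
Context {R : realType} {G X Y : topologicalType} {D : groupoid G X} {p : Y -> X}.
Context {a : action D p} (hD : lc_groupoid D) (hE : etale D) (ha : lc_gspace a).
Local Notation C := (set_type (crossed_set D p)).
Local Notation H := (crossed a).

Lemma hausdorff_crossed : hausdorff_space C.
Proof.
case: ha => hY _ _ _; apply/hausdorff_subtype/hausdorff_prod => //.
exact: (hausdorff_arrows hD).
Qed.

Lemma crossed_fst_continuous : continuous (fun c : C => (val c).1).
Proof.
move=> c; apply: (@continuous_comp C (Y * G)%type Y val fst c).
  exact: val_subtype_continuous.
exact: cvg_fst.
Qed.

Lemma crossed_snd_continuous : continuous (fun c : C => (val c).2).
Proof.
move=> c; apply: (@continuous_comp C (Y * G)%type G val snd c).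
  exact: val_subtype_continuous.
exact: cvg_snd.
Qed.

Lemma open_borel (t : C) (U : set C) : open U -> measurable (U : set (borel t)).
Proof. exact: sub_sigma_algebra. Qed.

Lemma closed_borel (t : C) (U : set C) :
  closed U -> measurable (U : set (borel t)).
Proof.
move=> cU; rewrite -[U]setCK; apply: measurableC; apply: open_borel.
exact: closed_openC.
Qed.

Lemma set1_borel (t c : C) : measurable ([set c] : set (borel t)).
Proof.
apply: closed_borel; apply: accessible_closed_set1; apply: hausdorff_accessible.
exact: hausdorff_crossed.
Qed.

Lemma continuous_borel (t : C) (f : C -> R) :
  continuous f -> measurable_fun setT (f : borel t -> R).
Proof.
move=> cf; apply: (measurability _ (RGenOInfty.measurableE R)) => _ [_ [x ->] <-].
by rewrite setTI; apply: open_borel; apply: open_comp.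
Qed.

Lemma crossed_fibreE y : [set c : C | crossed_rg c = y] = rg H @^-1` [set y].
Proof. by []. Qed.

Lemma closed_crossed_fibre y : closed [set c : C | crossed_rg c = y].
Proof.
rewrite (_ : [set c | _] = (fun c : C => (val c).1) @^-1` [set y])//.
apply: preimage_closed; first by move=> ? _; exact: crossed_fst_continuous.
by apply: accessible_closed_set1; apply: hausdorff_accessible; case: ha.
Qed.

Lemma compact_support_bounded (T : topologicalType) (f : T -> R) :
  continuous f -> compact (closure [set t | f t != 0]) ->
  exists2 M, 0 <= M & forall t, `|f t| <= M.
Proof.
move=> cf cK.
suff [M M0 fM] : exists2 M, 0 <= M &
    forall t, closure [set t | f t != 0] t -> `|f t| <= M.
  exists M => // t; have [->|ft] := eqVneq (f t) 0; first by rewrite normr0.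
  by apply: fM; apply: subset_closure.
apply: (@compact_ind _ _ (fun A => exists2 M, 0 <= M &
  forall t, A t -> `|f t| <= M) cK).
- by exists 0.
- by move=> A B AB [M M0 fM]; exists M => // t /AB /fM.
- move=> A B [M M0 fM] [N N0 fN]; exists (M + N); first exact: addr_ge0.
  by move=> t [/fM|/fN]; lra.
move=> t _; exists [set s | `|f t - f s| < 1].
  by have /cvgrPdist_lt /(_ 1 ltr01) := cf t.
exists (`|f t| + 1); first by rewrite addr_ge0.
move=> s /= fts; rewrite (_ : f s = f t - (f t - f s)); last by lra.
by apply: le_trans (ler_normB _ _) _; lra.
Qed.

Section density.
Variable w : Y -> G -> R.
Hypothesis w0 : forall y g, 0 <= w y g.
Hypothesis w1 : forall y, \esum_(g in [set g | rg D g = p y]) (w y g)%:E = 1%E.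

(** Extended by 0 off the fibre over [y], because [amenable] asks for measures on the whole crossed
    product. *)
Definition density (y : Y) (c : C) : R :=
  if (val c).1 == y then w y (val c).2 else 0.

Lemma density_ge0 y c : 0 <= density y c.
Proof. by rewrite /density; case: ifP. Qed.

Lemma esum_density y (A : set C) :
  \esum_(c in A) (density y c)%:E =
  \esum_(c in [set c | A c /\ crossed_rg c = y]) (w (val c).1 (val c).2)%:E.
Proof.
rewrite [RHS](esum_mkcondr A); apply: eq_esum => c Ac; rewrite /density.
case: eqP => cy; first by rewrite mem_set ?cy.
by rewrite memNset.
Qed.

Lemma density_sum y : \esum_(c in [set: C]) (density y c)%:E = 1%E.
Proof.
rewrite esum_density (_ : [set c | _] = [set c | crossed_rg c = y]).
  rewrite esum_crossed_fibre -(w1 y); apply: eq_esum => g /= gy.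
  by rewrite val_crossed_pt.
by apply/seteqP; split=> [c []|c].
Qed.

Definition density_probability (t : C) (y : Y) : probability (borel t) R :=
  @esum_probability R _ (borel t) (density y) (density_ge0 y) (density_sum y).

End density.
End reiter_amenable.

Lemma cvg_sum_seq (R : realType) (I : eqType) (T : Type) (F : set_system T)
    (f : I -> T -> R) (l : I -> R) (s : seq I) : Filter F ->
  (forall i, i \in s -> f i @ F --> l i) ->
  (fun t => \sum_(i <- s) f i t) @ F --> \sum_(i <- s) l i.
Proof.
move=> FF; elim: s => [_|i s ih fl].
  rewrite big_nil (_ : (fun _ => _) = cst 0); first exact: cvg_cst.
  by apply/funext => t; rewrite big_nil.
rewrite big_cons (_ : (fun _ => _) = (fun t => f i t + \sum_(j <- s) f j t)).
  apply: cvgD; first by apply: fl; exact: mem_head.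
  by apply: ih => j js; apply: fl; rewrite inE js orbT.
by apply/funext => t; rewrite big_cons.
Qed.

Lemma near_neq (T : Type) (U : topologicalType) (F : set_system T)
    (f g : T -> U) (x y : U) : Filter F -> hausdorff_space U -> x <> y ->
  f @ F --> x -> g @ F --> y -> \forall t \near F, f t <> g t.
Proof.
move=> FF; rewrite open_hausdorff => hU /eqP/hU [[A B] /= [xA yB] [oA oB /eqP AB]].
rewrite !inE in xA yB => fx gy.
have FA : \forall t \near F, A (f t) by exact: fx (open_nbhs_nbhs (conj oA xA)).
have FB : \forall t \near F, B (g t) by exact: gy (open_nbhs_nbhs (conj oB yB)).
near=> t => fg; have : (A `&` B) (f t).
  by split; [near: t|rewrite fg; near: t].
by rewrite AB.
Unshelve. all: by end_near. Qed.

(** * From densities to approximate invariant means *)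

Section reiter_to_amenable.
Context {R : realType} {G X Y : topologicalType} {D : groupoid G X} {p : Y -> X}.
Context {a : action D p} (hD : lc_groupoid D) (hE : etale D) (ha : lc_gspace a).
Local Notation C := (set_type (crossed_set D p)).
Local Notation H := (crossed a).
Variable w : Y -> G -> R.
Hypothesis wc : {within crossed_set D p, continuous (fun yg => w yg.1 yg.2)}.
Hypothesis w0 : forall y g, 0 <= w y g.
Hypothesis w1 : forall y, \esum_(g in [set g | rg D g = p y]) (w y g)%:E = 1%E.

Local Notation m y := (density_probability w0 w1 (crossed_un D p y) y).

Lemma density_probability_fibre y : m y (rg H @^-1` [set y]) = 1%E.
Proof.
rewrite /density_probability /esum_probability /= /esum_mass.
rewrite esum_density -(density_sum w1 y) esum_density.
by congr (esum _ _); apply/seteqP; split=> c [].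
Qed.

Lemma density_probability1 y g : rg D g = p y ->
  m y [set (crossed_pt y g : C)] = (w y g)%:E.
Proof.
move=> gy; rewrite /density_probability /esum_probability /= /esum_mass.
rewrite esum_set1 ?lee_fin ?density_ge0// /density val_crossed_pt//=.
by rewrite eqxx.
Qed.

(** Finitely many atoms carry almost all the mass at [y0]. Followed along local sections, they give
    sums [Phi] and [Psi] continuous in [y]. As the total mass is always 1, the mass [1 - Psi y] left
    out stays small near [y0], which controls the rest of the integral of a bounded [f]. *)
Lemma density_integral_continuous (f : C -> R) : continuous f ->
  compact (closure [set c | f c != 0]) ->
  continuous (fun y => Rintegral (m y) setT f).
Proof.
move=> cf /(compact_support_bounded cf) [M M0 fM] y0.
have cp : continuous p by case: ha.
have /choice [q qP] : forall g, exists q, local_section D q /\ q.2 g.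
  by move=> g; have [q] := etale_section g hE; exists q.
apply/cvgrPdist_lt => e e0.
(* The remainder costs [M * dl] at [y0] and [2 * M * dl] at [y], and [Phi] varies by less than
   [e / 4], which makes less than [e]; [M + 1] avoids a zero denominator. *)
pose dl := e / (4 * (M + 1)).
have dl0 : 0 < dl by rewrite /dl divr_gt0// mulr_gt0//; lra.
have Mdl : M * dl <= e / 4.
  have -> : e / 4 = dl * (M + 1) by rewrite /dl; field; lra.
  by rewrite mulrDr mulr1 mulrC lerDl ltW.
have [s [us sy0 ws]] : exists s : seq G, [/\ uniq s,
    forall g, g \in s -> rg D g = p y0 & 1 - dl < \sum_(g <- s) w y0 g].
  have : ((1 - dl)%:E < \esum_(g in [set g | rg D g = p y0]) (w y0 g)%:E)%E.
    by rewrite w1 lte_fin; lra.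
  move=> /ereal_sup_gt [_ [A [/finite_seqP [s ->] AS] <-]].
  rewrite (_ : [set` s] = [set` undup s]); last first.
    by apply/seteqP; split=> g /=; rewrite mem_undup.
  rewrite -fsbig_seq ?undup_uniq// sumEFin lte_fin => ws.
  exists (undup s); split => //; first exact: undup_uniq.
  by move=> g; rewrite mem_undup => /AS.
pose sg g y := (q g).1 (p y).
pose c g y := crossed_pt y (sg g y) : C.
have sg0 g : g \in s -> sg g y0 = g.
  by move=> gs; have [[_ qE _] qg] := qP g; rewrite /sg -(sy0 _ gs) qE.
have sgr g : g \in s -> \forall y \near y0, rg D (sg g y) = p y.
  move=> gs; have [[oq qE _] qg] := qP g.
  have : nbhs (p y0) (rg D @` (q g).2).
    by apply: open_nbhs_nbhs; split; [exact: rg_open|exists g => //; exact: sy0].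
  move=> /(cp y0) W; apply: (@filterS _ (nbhs y0) _ _ _ _ W) => y [h qh hy].
  by rewrite /sg -hy qE.
have sgc g : g \in s -> sg g y @[y --> y0] --> g.
  move=> gs; have [[_ _ qc] qg] := qP g; rewrite -[X in _ --> X]sg0//.
  apply: (@continuous_comp _ _ _ p (q g).1); first exact: cp.
  by rewrite -(sy0 _ gs); exact: qc.
have wcv g : g \in s -> w y (sg g y) @[y --> y0] --> w y0 g.
  move=> gs; apply: (@within_cvg2 _ (nbhs y0) _ _ _ _ w id (sg g) y0 g _ wc) => //.
  - by rewrite /crossed_set /= sy0.
  - exact: sgc.
  by apply: filterS (sgr g gs) => y; rewrite /crossed_set /= => ->.
have fcv g : g \in s -> f (c g y) @[y --> y0] --> f (c g y0).
  move=> gs; apply: continuous_cvg; first exact: cf.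
  apply: cvg_subtype; rewrite val_crossed_pt ?sg0 ?sy0//.
  apply: (@cvg_trans _ ((y, sg g y) @[y --> y0])).
    apply: near_eq_cvg; apply: filterS (sgr g gs) => y ry.
    by rewrite val_crossed_pt.
  by apply: cvg_pair; [exact: cvg_id|exact: sgc].
(* [Rintegral_seqE] needs distinct atoms: sections through different arrows keep apart near [y0]
   because [G] is Hausdorff. *)
have un : \forall y \near y0, uniq [seq c g y | g <- s].
  have inj : \forall y \near y0, forall g, g \in s -> forall h, h \in s ->
      g <> h -> sg g y <> sg h y.
    apply: near_all_seq => g gs; apply: near_all_seq => h hs.
    have [->|/eqP gh] := eqVneq g h; first by near=> y.
    by apply: filterS (near_neq _ (hausdorff_arrows hD) gh (sgc _ gs) (sgc _ hs)).
  have rs : \forall y \near y0, forall g, g \in s -> rg D (sg g y) = p y.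
    exact: near_all_seq.
  near=> y; rewrite map_inj_in_uniq// => g h gs hs /(congr1 val).
  have rsy : forall g, g \in s -> rg D (sg g y) = p y by near: y.
  rewrite !val_crossed_pt ?rsy// => -[]; apply: contraPP.
  by move: g h gs hs; near: y; apply: filterS inj => y iy g h /iy ig /ig.
pose Phi y := \sum_(g <- s) f (c g y) * w y (sg g y).
pose Psi y := \sum_(g <- s) w y (sg g y).
have est y : (forall g, g \in s -> rg D (sg g y) = p y) ->
    uniq [seq c g y | g <- s] ->
  `|Rintegral (m y) setT f - Phi y| <= M * (1 - Psi y).
  move=> rs us'; have mf := continuous_borel (t := crossed_un D p y) cf.
  have m1 t : measurable ([set t] : set (borel (crossed_un D p y))).
    exact: (set1_borel hD ha).
  have E u : \sum_(c <- [seq c g y | g <- s]) u c * fine (m y [set c]) =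
      \sum_(g <- s) u (c g y) * w y (sg g y).
    rewrite big_map big_seq [RHS]big_seq; apply: eq_bigr => g gs.
    by rewrite density_probability1 ?rs.
  rewrite (Rintegral_seqE (m y) mf fM m1 us') E addrAC subrr add0r.
  have mS : measurable (~` [set` [seq c g y | g <- s]] :
      set (borel (crossed_un D p y))).
    by apply: measurableC; apply: countable_measurable => //;
      exact/finite_set_countable/finite_seq.
  apply: le_trans (normr_Rintegral_le (m y) mf fM mS) _.
  rewrite ler_wpM2l//.
  have c1 (t : borel (crossed_un D p y)) : `|cst (1 : R) t| <= 1.
    by rewrite normr1.
  (* Applied to the constant 1, the same decomposition gives the mass of the remainder as
     [1 - Psi y]. *)
  have := @Rintegral_seqE _ _ _ (m y) (cst 1) 1 (measurable_cst _) c1 m1 _ us'.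
  rewrite E; set I1 := Rintegral _ _ _; set I2 := Rintegral _ _ _.
  have -> : I1 = 1.
    rewrite /I1 Rintegral_cst// mul1r.
    rewrite -[RHS]/(fine 1%E); congr fine; exact: (probability_setT (m y)).
  have -> : I2 = fine (m y (~` [set` [seq c g y | g <- s]])).
    by rewrite /I2 Rintegral_cst// mul1r.
  under eq_bigr do rewrite mul1r.
  by move=> ->; rewrite -/(Psi y); lra.
have Phic : Phi y @[y --> y0] --> Phi y0.
  apply: (@cvg_sum_seq _ _ _ _ (fun g y => f (c g y) * w y (sg g y))) => g gs.
  by apply: cvgM; [exact: fcv|rewrite sg0//; exact: wcv].
have Psic : Psi y @[y --> y0] --> Psi y0.
  apply: (@cvg_sum_seq _ _ _ _ (fun g y => w y (sg g y))) => g gs.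
  by rewrite sg0//; exact: wcv.
have Psi0 : 1 - dl < Psi y0.
  by rewrite /Psi big_seq; under eq_bigr => g gs do rewrite sg0//; rewrite -big_seq.
have rs : \forall y \near y0, forall g, g \in s -> rg D (sg g y) = p y.
  exact: near_all_seq.
have est0 := est y0 (nbhs_singleton rs) (nbhs_singleton un).
move/cvgrPdist_lt : Phic => /(_ (e / 4)) Phic.
move/cvgrPdist_lt : Psic => /(_ dl dl0) Psic.
near=> y.
have ey : `|Rintegral (m y) setT f - Phi y| <= M * (1 - Psi y).
  by apply: est; near: y.
have e4 : `|Phi y0 - Phi y| < e / 4 by near: y; apply: Phic; lra.
have d : `|Psi y0 - Psi y| < dl by near: y.
have k0 : M * (1 - Psi y0) <= M * dl by apply: ler_wpM2l => //; lra.
have k1 : M * (1 - Psi y) <= M * (dl + dl).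
  by apply: ler_wpM2l => //; move: d; rewrite ltr_norml => /andP[]; lra.
rewrite mulrDr in k1.
have := e4; have := ey; have := est0; rewrite !ler_norml !ltr_norml.
move=> /andP[? ?] /andP[? ?] /andP[? ?].
by apply/andP; split; lra.
Unshelve. all: by end_near. Qed.

End reiter_to_amenable.

Lemma esum_subset (R : realType) (T : choiceType) (S S' : set T)
    (f : T -> \bar R) : (forall t, (0 <= f t)%E) -> S `<=` S' ->
  (\esum_(t in S) f t <= \esum_(t in S') f t)%E.
Proof.
move=> f0 SS'; rewrite esum_mkcond [leRHS]esum_mkcond; apply: le_esum => t _.
case: ifPn => [|_]; last by case: ifP.
by rewrite inE => /SS' /mem_set ->.
Qed.

(** After exchanging the sums, each [t] contributes at most once, since it lies in at most one
    [A k]. *)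
Lemma sum_esum_trivIset (R : realType) (T : choiceType) n (A : 'I_n -> set T)
    (S : set T) (f : T -> \bar R) : (forall t, (0 <= f t)%E) -> trivIset setT A ->
  (\sum_(k < n) \esum_(t in [set t | A k t /\ S t]) f t <=
    \esum_(t in S) f t)%E.
Proof.
move=> f0 tA.
under eq_bigr => k _ do rewrite (esum_mkcondl (A k)).
rewrite -esum_sum; last by move=> t k _ _; case: ifP.
apply: le_esum => t _; have [[k Ak]|nA] := pselect (exists k, A k t).
  rewrite (bigD1 k)//= mem_set// big1 ?adde0// => j jk.
  rewrite memNset// => Aj; move/eqP: jk; apply.
  by apply: (tA j k) => //; exists t.
by rewrite big1// => k _; rewrite memNset// => Ak; apply: nA; exists k.
Qed.

Section reiter_amenable.
Context {R : realType} {G X Y : topologicalType} {D : groupoid G X} {p : Y -> X}.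
Context {a : action D p} (hD : lc_groupoid D) (hE : etale D) (ha : lc_gspace a).
Local Notation C := (set_type (crossed_set D p)).
Local Notation H := (crossed a).

Section density_translate.
Variable w : Y -> G -> R.
Hypothesis w0 : forall y g, 0 <= w y g.
Hypothesis w1 : forall y, \esum_(g in [set g | rg D g = p y]) (w y g)%:E = 1%E.
Local Notation m y := (density_probability w0 w1 (crossed_un D p y) y).

(** For a disjoint family the absolute values pass inside the sums and the pieces merge into one sum
    over the fibre of [k]; translating the measure by [k] shifts both arguments of [w]. *)
Lemma density_total_variation (k : C) :
  (total_variation_dist (translate H k (m (sc H k))) (m (rg H k)) <=
   \esum_(h in [set h | rg D h = rg D (val k).2])
     `|w (act a (inv D (val k).2) (val k).1) (mul D (inv D (val k).2) h)
       - w (val k).1 h|%:E)%E.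
Proof.
apply: ge_ereal_sup => _ [n [A [_ tA ->]]].
pose u (c : C) := density w (sc H k) (mul H (inv H k) c).
pose v (c : C) := density w (rg H k) c.
have u0 c : 0 <= u c by exact: density_ge0.
have v0 c : 0 <= v c by exact: density_ge0.
have transE B : translate H k (m (sc H k)) B =
    \esum_(c in [set c | B c /\ rg H c = rg H k]) (u c)%:E.
  exact: reindex_esum (translate_bij (D := H) k B).
have mE B : m (rg H k) B = \esum_(c in [set c | B c /\ rg H c = rg H k]) (v c)%:E.
  rewrite /density_probability /esum_probability /= /esum_mass.
  rewrite (esum_mkcondr B); apply: eq_esum => c Bc; rewrite /v.
  case: ifPn => //; rewrite notin_setE => nc; rewrite /density ifF//.
  exact/eqP.
have sub (B : set C) : (\esum_(c in B) (v c)%:E \is a fin_num)%E.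
  rewrite ge0_fin_numE ?esum_ge0// => [|c _]; last by rewrite lee_fin.
  apply: (@le_lt_trans _ _ 1%E); last exact: ltry.
  by rewrite -(density_sum w1 (rg H k)); apply: esum_subset => // c;
    rewrite lee_fin.
have sub' (B : set C) :
    (\esum_(c in [set c | B c /\ rg H c = rg H k]) (u c)%:E \is a fin_num)%E.
  rewrite -transE /translate /density_probability /esum_probability /= /esum_mass.
  rewrite ge0_fin_numE ?esum_ge0// => [|c _]; last by rewrite lee_fin density_ge0.
  apply: (@le_lt_trans _ _ 1%E); last exact: ltry.
  by rewrite -(density_sum w1 (sc H k)); apply: esum_subset => // c;
    rewrite lee_fin density_ge0.
apply: (@le_trans _ _ (\sum_(j < n)
    \esum_(c in [set c | A j c /\ rg H c = rg H k]) `|u c - v c|%:E)%E).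
  by apply: lee_sum => j _; rewrite transE mE; apply: abs_esumB.
apply: (@le_trans _ _ (\esum_(c in [set c | crossed_rg c = rg H k])
    `|u c - v c|%:E)%E).
  by apply: sum_esum_trivIset => // c; rewrite lee_fin.
rewrite esum_crossed_fibre /= /crossed_rg -crossedP; apply: le_esum => h /= hk.
have hk' : rg D h = rg D (val k).2 by rewrite hk crossedP.
rewrite lee_fin /u /v /density.
have cv : val (crossed_pt (val k).1 h : C) = ((val k).1, h).
  by rewrite val_crossed_pt.
have -> : mul H (inv H k) (crossed_pt (val k).1 h) =
    crossed_mul (crossed_inv a k) (crossed_pt (val k).1 h) by [].
by rewrite val_crossed_mul cv/= ?eqxx// sc_inv hk'.
Qed.

End density_translate.

Lemma reiter_amenable : reiter R a -> amenable R H.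
Proof.
(* One density is chosen for each compact set and error; these pairs, with growing sets and
   shrinking errors, index the net. *)
move=> ra; pose I := {i : set G * R | compact i.1 /\ 0 < i.2}.
have /choice [w wP] : forall i : I, exists w : Y -> G -> R,
  [/\ {within crossed_set D p, continuous (fun yg => w yg.1 yg.2)},
    forall y g, 0 <= w y g,
    forall y, \esum_(g in [set g | rg D g = p y]) (w y g)%:E = 1%E &
    forall y g, (sval i).1 g -> rg D g = p y ->
      (\esum_(h in [set h | rg D h = rg D g])
        `|w (act a (inv D g) y) (mul D (inv D g) h) - w y h|%:E
          <= (sval i).2%:E)%E].
  by move=> i; have [cL e0] := svalP i; exact: ra.
have wc i : {within crossed_set D p, continuous (fun yg => w i yg.1 yg.2)}.
  by case: (wP i).
have w0 i : forall y g, 0 <= w i y g by case: (wP i).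
have w1 i : forall y, \esum_(g in [set g | rg D g = p y]) (w i y g)%:E = 1%E.
  by case: (wP i).
exists I, (fun i j => (sval i).1 `<=` (sval j).1 /\ (sval j).2 <= (sval i).2),
  (fun i y => density_probability (w0 i) (w1 i) (crossed_un D p y) y); split.
- split.
  + by apply: inhabits; exists (set0, 1); split => //; exact: compact0.
  + by move=> i; split.
  + move=> i j k [ij ji] [jk kj]; split; first exact: subset_trans jk.
    exact: le_trans ji.
  + move=> [[K e] [/= cK e0]] [[L d] [/= cL d0]].
    have P : compact (K `|` L) /\ 0 < Num.min e d.
      by split; [exact: compactU|rewrite lt_min e0].
    exists (exist _ (K `|` L, Num.min e d) P) => /=.
    by rewrite !ge_min !lexx orbT; split; split.
- by move=> i y; exact: density_probability_fibre.
- by move=> i f cf sf; exact: (density_integral_continuous hD hE ha (wc i)).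
move=> K e cK e0.
(* Only the projection of [K] to [G] matters, because [reiter] is uniform in the point of [Y]. *)
have P : compact ((fun c : C => (val c).2) @` K) /\ 0 < e.
  split=> //; apply: continuous_compact => //; apply: continuous_subspaceT.
  exact: crossed_snd_continuous.
exists (exist _ (_, e) P) => i [/= Ki ei] k Kk.
apply: (le_trans (density_total_variation (w0 i) (w1 i) k)).
have [_ _ _ wi] := wP i.
apply: le_trans (_ : ((sval i).2)%:E <= _)%E; last by rewrite lee_fin.
by apply: wi; [apply: Ki; exists k|rewrite crossedP].
Qed.

End reiter_amenable.

(** * From approximate invariant means to densities *)

Section amenable_reiter.
Context {R : realType} {G X Y : topologicalType} {D : groupoid G X} {p : Y -> X}.
Context {a : action D p} (hD : lc_groupoid D) (hE : etale D) (ha : lc_gspace a).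
Local Notation C := (set_type (crossed_set D p)).
Local Notation H := (crossed a).

Lemma closed_crossed_set : closed (crossed_set D p).
Proof.
have cp : continuous p by case: ha.
rewrite closedE => -[y g]; apply: contra_notP => /= yg.
have := @near_neq _ _ (nbhs (y, g)) (fun z => p z.1) (fun z => rg D z.2) _ _ _
  (hausdorff_units hD) yg; apply.
- apply: (@cvg_comp _ _ _ fst p _ (nbhs y)); [exact: cvg_fst|exact: cp].
- apply: (@cvg_comp _ _ _ snd (rg D) _ (nbhs g)); first exact: cvg_snd.
  exact: (rg_continuous hD).
Qed.

(** The first coordinate lies over the ranges of arrows in [L], hence in a compact set by properness
    of [p]; composability is a closed condition. *)
Lemma compact_crossed (L : set G) : proper_map p -> compact L ->
  compact [set c : C | L (val c).2].
Proof.
move=> pp cL.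
have cK : compact ((p @^-1` (rg D @` L)) `*` L `&` crossed_set D p).
  apply: compact_closedI closed_crossed_set.
  apply: compact_setX => //; apply: pp; apply: continuous_compact => //.
  exact/continuous_subspaceT/(rg_continuous hD).
have := compact_subtype cK (@subIsetr _ _ _).
congr compact; apply/seteqP; split=> [c [[_ ?] _]//|c /= Lc].
split; last exact: crossedP.
by split=> //; exists (val c).2 => //; rewrite crossedP.
Qed.

(** A test function that meets the fibre over [y] only at [c] reads off the atom at [c], the
    complement of the fibre being null. *)
Lemma Rintegral_fibre_point (t : C) (P : probability (borel t) R) (y : Y)
    (f : C -> R) (M : R) (c : C) : continuous f -> (forall c, `|f c| <= M) ->
  P (rg H @^-1` [set y]) = 1%E -> crossed_rg c = y ->
  (forall d, crossed_rg d = y -> d <> c -> f d = 0) ->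
  Rintegral P setT f = f c * fine (P [set c]).
Proof.
move=> cf fM Py cy f0; have mf := continuous_borel (t := t) cf.
have m1 (s : borel t) : measurable [set s] by exact: (set1_borel hD ha).
have mF : measurable (rg H @^-1` [set y] : set (borel t)).
  exact: (closed_borel (closed_crossed_fibre ha (y := y))).
rewrite (Rintegral_seqE P mf fM m1 (s := [:: c]))// big_seq1.
rewrite -[RHS]addr0; congr (_ + _).
have -> : ~` [set` [:: c]] = (rg H @^-1` [set y] `\ c) `|`
    (~` (rg H @^-1` [set y]) : set (borel t)).
  apply/seteqP; split=> [d /=|d [[_ /= dc]|/= dy]]; rewrite inE.
  - move=> /negP dc; have [dy|] := pselect (crossed_rg d = y); last by right.
    by left; split => //; apply/eqP.
  - exact/negP/eqP.
  - by apply/negP/eqP => dc; apply: dy; rewrite dc.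
rewrite Rintegral_setU//; last 4 first.
- exact: measurableD.
- exact: measurableC.
- apply: (bounded_integrable P mf fM); apply: measurableU; last exact: measurableC.
  exact: measurableD.
- by apply/disj_setPS => d [[? _]].
rewrite (@eq_Rintegral _ _ _ _ _ (cst 0)); last first.
  by move=> d; rewrite inE => -[dy dc]; exact: f0.
rewrite Rintegral_cst ?mul0r ?add0r; last exact: measurableD.
apply/eqP; rewrite -normr_le0.
apply: le_trans (normr_Rintegral_le P mf fM (measurableC mF)) _.
by rewrite probability_setC// Py subee//= mulr0.
Qed.

(** The density is the mass of single points, which sums to 1 because fibres are countable. One
    index of the net, taken for the compact set of all pairs with arrow in [L], is enough. *)
Lemma amenable_reiter : proper_map p -> amenable R H -> reiter R a.
Proof.
move=> pp [I [le [m [[_ lexx _ _] mF mc mT]]]] L e cL e0.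
have cp : continuous p by case: ha.
have [i0 /(_ i0 (lexx i0)) mi] := mT _ e (compact_crossed pp cL) e0.
exists (fun y g => fine (m i0 y [set c | val c = (y, g)])).
have ptE y g : rg D g = p y ->
    [set c : C | val c = (y, g)] = [set crossed_pt y g : C].
  move=> gy; apply/seteqP; split=> c /=.
    by move=> cE; apply: val_inj; rewrite val_crossed_pt.
  by move=> ->; rewrite val_crossed_pt.
have m1 (s t : C) : measurable ([set s] : set (borel t)).
  exact: (set1_borel hD ha).
have EFw y g : rg D g = p y ->
    (fine (m i0 y [set c | val c = (y, g)]))%:E = m i0 y [set crossed_pt y g].
  by move=> gy; rewrite ptE// fineK// fin_num_measure.
split.
- apply/subspace_continuousP => -[y0 g0] /= yg0.
  have [q [oq qE _] qg0] := etale_section g0 hE.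
  (* A cutoff supported in one local section meets each fibre in at most one point and is 1 near
     [g0]. Its integral is thus the density at arrows near [g0], and [mc] gives continuity. *)
  have [e1 [N [ce e01 [oN Ng0] eN [cse seU]]]] := @urysohn_lc R G
    (hausdorff_arrows hD) (lc_arrows hD) [set g0] q.2 (@compact_set1 _ _) oq
    (fun g gE => eq_ind_r q.2 qg0 gE).
  pose f (c : C) := e1 (val c).2.
  have cf : continuous f.
    move=> c; apply: (@continuous_comp C G R (fun c => (val c).2) e1).
      exact: crossed_snd_continuous.
    exact: ce.
  have sf : compact (closure [set c | f c != 0]).
    apply: subclosed_compact (compact_crossed pp cse) _.
      exact: closed_closure.
    have clc : closed [set c : C | closure [set g | e1 g != 0] (val c).2].
      apply: preimage_closed (@closed_closure _ _).
      by move=> c _; exact: crossed_snd_continuous.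
    rewrite [X in X `<=` _]closureE => c; apply; split => // d fd.
    exact: subset_closure.
  have f1 c : `|f c| <= 1 by have /andP[? ?] := e01 (val c).2; rewrite ger0_norm.
  have mE y g : rg D g = p y -> N g ->
      fine (m i0 y [set c | val c = (y, g)]) = Rintegral (m i0 y) setT f.
    move=> gy Ng; have qn h : e1 h != 0 -> q.2 h.
      by move=> h0; apply: seU; exact: subset_closure.
    rewrite ptE// (Rintegral_fibre_point (c := crossed_pt y g) cf f1 (mF i0 y)).
    + by rewrite /f val_crossed_pt//= eN// mul1r.
    + by rewrite /crossed_rg val_crossed_pt.
    + move=> d dy dc; apply/eqP; apply: contra_notT dc => /qn qd.
      rewrite -[d]crossed_ptK; congr crossed_pt; first exact: dy.
      have qg : q.2 g by apply: qn; rewrite eN// oner_eq0.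
      by rewrite -(qE _ qd) -(qE _ qg) gy -crossedP -dy.
  have Ng0' : N g0 by exact: Ng0.
  rewrite [X in _ --> X](mE y0 g0 (esym yg0) Ng0').
  apply: (@cvg_trans _ ((fun yg : Y * G => Rintegral (m i0 yg.1) setT f) @
    within (crossed_set D p) (nbhs (y0, g0)))).
    apply: near_eq_cvg.
    have nN : \forall yg \near (y0, g0), N yg.2.
      have : nbhs g0 N by exact: open_nbhs_nbhs.
      by move/(@cvg_snd _ _ (nbhs y0) (nbhs g0) _).
    rewrite /within /=; apply: filterS nN => -[y g] /= Ng yg.
    exact: esym (mE y g (esym yg) Ng).
  apply: (@cvg_comp _ _ _ fst (fun y => Rintegral (m i0 y) setT f) _ (nbhs y0)).
    move=> U Uy; have : nbhs (y0, g0) (fst @^-1` U) by exact: cvg_fst.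
    by apply: filterS => z ? ?.
  exact: mc.
- by move=> y g; exact: fine_ge0.
- move=> y; rewrite -(mF i0 y) measure_countable.
  + rewrite -(crossed_fibreE (a := a) y) esum_crossed_fibre.
    by apply: eq_esum => g /= gy; rewrite EFw.
  + by move=> s; exact: m1.
  + apply: sub_countable (countable_fibre hD (p y) hE).
    rewrite -crossed_fibreE; have [_ _ sj] := @crossed_fibre_bij _ _ _ D p y.
    exact: card_le_trans (subset_card_le sj) (card_image_le _ _).
- move=> y g Lg gy; pose k : C := crossed_pt y g.
  have vk : val k = (y, g) by rewrite /k val_crossed_pt.
  have skE : sc H k = act a (inv D g) y by rewrite /= /crossed_sc vk.
  have rkE : rg H k = y by rewrite /= /crossed_rg vk.
  have := mi k; rewrite /= vk => /(_ Lg); apply: le_trans.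
  (* A finite partial sum is one of the values whose supremum is the total variation distance: the
     one for a family of singletons. *)
  apply: ge_ereal_sup => _ [A [/finite_seqP [s ->] As] <-].
  rewrite (_ : [set` s] = [set` undup s]); last first.
    by apply/seteqP; split=> h /=; rewrite mem_undup.
  rewrite -fsbig_seq ?undup_uniq// big_tnth.
  apply: ereal_sup_ubound; set n := size (undup s).
  pose h (j : 'I_n) := tnth (in_tuple (undup s)) j.
  have hr j : rg D (h j) = p y.
    by rewrite -gy; apply: As => /=; rewrite -mem_undup; exact: mem_tnth.
  exists n, (fun j => [set (crossed_pt y (h j) : C)]); split.
  + by move=> j; exact: m1.
  + move=> i j _ _ [c [/= -> /(congr1 val)]]; rewrite !val_crossed_pt// => -[].
    have /tuple_uniqP inj : uniq (in_tuple (undup s)) by exact: undup_uniq.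
    exact: inj.
  + apply: eq_bigr => j _; rewrite -/(h j).
    have r1 : rg D (mul D (inv D g) (h j)) = p (sc H k).
      by rewrite rg_mul ?rg_inv ?sc_inv ?hr// skE act_p ?rg_inv ?sc_inv.
    have -> : translate H k (m i0 (sc H k)) [set (crossed_pt y (h j) : C)] =
        m i0 (sc H k) [set (crossed_pt (sc H k) (mul D (inv D g) (h j)) : C)].
      congr (m i0 (sc H k) _); apply/seteqP; split=> [c [cr]|c ->].
        move=> /(congr1 val); rewrite val_crossed_mul ?vk/= ?val_crossed_pt//.
          move=> [ch]; apply: val_inj; rewrite val_crossed_pt// -ch mulgK.
            by rewrite -[crossed_sc a k]cr -surjective_pairing.
          by rewrite -crossedP -[(val c).1]/(rg H c) cr skE act_p ?rg_inv ?sc_inv.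
        by rewrite -crossedP -[(val c).1]/(rg H c) cr skE act_p ?rg_inv ?sc_inv.
      split; first by rewrite /= /crossed_rg val_crossed_pt.
      apply: val_inj; rewrite val_crossed_mul ?vk/= ?val_crossed_pt//=.
        by rewrite mulKg// hr.
      by rewrite rg_mul ?rg_inv ?sc_inv ?hr.
    have -> : m i0 (rg H k) [set (crossed_pt y (h j) : C)] =
        (fine (m i0 y [set c | val c = (y, h j)]))%:E.
      by rewrite EFw// rkE.
    by rewrite -(EFw _ _ r1) skE -EFinD abse_EFin.
Qed.

End amenable_reiter.

(** * Characters of [C0r] *)

Section complex_topology.
Context {R : realType}.
Local Notation C := (R[i]^o).

Lemma normc_le_parts (a b r : R) : `|((a +i* b)%C : C)| <= r%:C%C -> `|a| <= r /\ `|b| <= r.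
Proof.
rewrite (_ : `|_| = (Num.sqrt (a ^+ 2 + b ^+ 2))%:C%C)// lecR => ler; split.
  apply: le_trans ler; rewrite -sqrtr_sqr ler_sqrt ?lerDl ?sqr_ge0//.
  by rewrite addr_ge0 ?sqr_ge0.
apply: le_trans ler; rewrite -sqrtr_sqr ler_sqrt ?lerDr ?sqr_ge0//.
by rewrite addr_ge0 ?sqr_ge0.
Qed.

Lemma normc_le_add (a b r : R) : `|a| + `|b| <= r -> `|((a +i* b)%C : C)| <= r%:C%C.
Proof.
move=> ler; rewrite (_ : `|_| = (Num.sqrt (a ^+ 2 + b ^+ 2))%:C%C)// lecR.
have r0 : 0 <= r by apply: le_trans ler; rewrite addr_ge0.
rewrite -(ger0_norm r0) -sqrtr_sqr ler_sqrt ?sqr_ge0//.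
apply: le_trans (_ : (`|a| + `|b|) ^+ 2 <= _).
  rewrite -[a ^+ 2]real_normK ?num_real// -[b ^+ 2]real_normK ?num_real//.
  by have := mulr_ge0 (normr_ge0 a) (normr_ge0 b); rewrite sqrrD; lra.
by rewrite ler_pXn2r// nnegrE addr_ge0.
Qed.

Lemma cvg_complexP (T : Type) (F : set_system T) (f : T -> C) (a b : R) :
  Filter F ->
  f @ F --> ((a +i* b)%C : C) <->
  (fun t => complex.Re (f t)) @ F --> a /\ (fun t => complex.Im (f t)) @ F --> b.
Proof.
move=> FF; split=> [fab|[fa fb]].
  suff E (e : R) : 0 < e -> \forall t \near F,
      `|a - complex.Re (f t)| < e /\ `|b - complex.Im (f t)| < e.
    by split; apply/cvgrPdist_lt => e /E; apply: filterS => t [].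
  move=> e0; have e2 : (0 : R[i]) < (e / 2)%:C%C by rewrite ltcR divr_gt0.
  move/cvgrPdist_lt : fab => /(_ _ e2); apply: filterS => t /ltW.
  case: (f t) => c d /=.
  rewrite (_ : (a +i* b)%C - (c +i* d)%C = ((a - c) +i* (b - d))%C)//.
  by move=> /normc_le_parts [? ?]; split; lra.
apply/cvgrPdist_lt => -[e d]; rewrite ltcE /= => /andP[/eqP -> e0].
have e4 : 0 < e / 4 by rewrite divr_gt0.
move/cvgrPdist_lt : fa => /(_ _ e4) fa; move/cvgrPdist_lt : fb => /(_ _ e4) fb.
near=> t; apply: le_lt_trans (_ : (e / 2)%:C%C < _); last by rewrite ltcR; lra.
have : `|a - complex.Re (f t)| < e / 4 by near: t.
have : `|b - complex.Im (f t)| < e / 4 by near: t.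
case: (f t) => c c' /= h1 h2.
rewrite (_ : (a +i* b)%C - (c +i* c')%C = ((a - c) +i* (b - c'))%C)//.
by apply: normc_le_add; lra.
Unshelve. all: by end_near. Qed.

Lemma continuous_complexP (T : topologicalType) (f : T -> C) :
  continuous f <-> continuous (fun t => complex.Re (f t)) /\
                   continuous (fun t => complex.Im (f t)).
Proof.
have E t : f t = (complex.Re (f t) +i* complex.Im (f t))%C by case: (f t).
split=> [cf|[cr ci] t].
  by split=> t; have := cf t; rewrite /continuous_at E => /cvg_complexP [].
by rewrite /continuous_at E; apply/cvg_complexP; split; [exact: cr|exact: ci].
Qed.

Lemma complex_hausdorff : hausdorff_space C.
Proof. exact: norm_hausdorff. Qed.

End complex_topology.

(** * Real functions in [C0r] *)

Section vanishing.
Context {R : realType} {G X : topologicalType} {D : groupoid G X}.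
Hypothesis hD : lc_groupoid D.

Definition bounded_cont (f : G -> R) :=
  continuous f /\ exists M, forall g, `|f g| <= M.

(* These are the real-valued elements of [C0r R D], see [C0rP]. *)
Definition vanishing (f : G -> R) := bounded_cont f /\
  forall e, 0 < e -> exists2 K : set X, compact K &
    forall g, ~ K (rg D g) -> `|f g| <= e.

Lemma bounded_contD f g : bounded_cont f -> bounded_cont g ->
  bounded_cont (fun x => f x + g x).
Proof.
move=> [cf [M fM]] [cg [N gN]]; split.
  by move=> x; apply: cvgD; [exact: cf|exact: cg].
exists (M + N) => x; apply: le_trans (ler_normD _ _) _.
by apply: lerD.
Qed.

Lemma bounded_contM f g : bounded_cont f -> bounded_cont g ->
  bounded_cont (fun x => f x * g x).
Proof.
move=> [cf [M fM]] [cg [N gN]]; split.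
  by move=> x; apply: cvgM; [exact: cf|exact: cg].
by exists (M * N) => x; rewrite normrM ler_pM.
Qed.

Lemma bounded_cont_cst (r : R) : bounded_cont (cst r).
Proof. by split; [exact: cst_continuous|exists `|r|]. Qed.

Lemma vanishingM f g : vanishing f -> bounded_cont g ->
  vanishing (fun x => f x * g x).
Proof.
move=> [bf vf] bg; split; first exact: bounded_contM.
move=> e e0; have [_ [M gM]] := bg.
have M0 : 0 < `|M| + 1 by rewrite ltr_wpDl.
have [K cK fK] := vf (e / (`|M| + 1)) (divr_gt0 e0 M0).
exists K => // x /fK fx; rewrite normrM -[e](@divfK _ (`|M| + 1)) ?gt_eqF//.
apply: ler_pM => //; apply: le_trans (gM x) _.
by apply: le_trans (ler_norm M) _; rewrite lerDl.
Qed.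

Lemma vanishingD f g : vanishing f -> vanishing g ->
  vanishing (fun x => f x + g x).
Proof.
move=> [bf vf] [bg vg]; split; first exact: bounded_contD.
move=> e e0; have e2 : 0 < e / 2 by rewrite divr_gt0.
have [K cK fK] := vf _ e2; have [L cL gL] := vg _ e2.
exists (K `|` L); first exact: compactU.
move=> x /not_orP [/fK fx /gL gx]; apply: le_trans (ler_normD _ _) _; lra.
Qed.

Lemma vanishingZ (r : R) f : vanishing f -> vanishing (fun x => r * f x).
Proof.
move=> vf; rewrite (_ : (fun _ => _) = (fun x => f x * cst r x)).
  exact/vanishingM/bounded_cont_cst.
by apply/funext => x; rewrite mulrC.
Qed.

Lemma vanishing0 : vanishing (cst 0).
Proof.
split; first exact: bounded_cont_cst.
by move=> e e0; exists set0 => [|x _]; [exact: compact0|rewrite normr0 ltW].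
Qed.

Lemma vanishing_comp_rg (f : X -> R) : continuous f ->
  compact (closure [set x | f x != 0]) -> vanishing (fun g => f (rg D g)).
Proof.
move=> cf sf; have [M M0 fM] := compact_support_bounded cf sf; split.
  split; last by exists M => g.
  by move=> g; apply: continuous_comp; [exact: rg_continuous|exact: cf].
move=> e e0; exists (closure [set x | f x != 0]) => // g.
apply: contra_notP => /negP; rewrite -ltNge => fg; apply: subset_closure.
by rewrite /= -normr_gt0; exact: lt_trans fg.
Qed.

(** This allows working with real functions only. For the converse, [f] is approximated by its
    product with a cutoff on the unit space that is 1 wherever one of the two parts may be large. *)
Lemma C0rP (f : G -> R[i]^o) : C0r R D f <->
  vanishing (fun g => complex.Re (f g)) /\ vanishing (fun g => complex.Im (f g)).
Proof.
have fE g : f g = (complex.Re (f g) +i* complex.Im (f g))%C by case: (f g).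
split=> [[[/continuous_complexP [cr ci] [M fM]] vf]|].
  have fM' g : `|complex.Re (f g)| <= M /\ `|complex.Im (f g)| <= M.
    by apply: normc_le_parts; rewrite -fE.
  have v e : 0 < e -> exists2 K : set X, compact K & forall g, ~ K (rg D g) ->
      `|complex.Re (f g)| <= e /\ `|complex.Im (f g)| <= e.
    move=> /vf [h [K [_ cK hK fh]]]; exists K => // g gK.
    apply: normc_le_parts; rewrite -fE; have := fh g; suff -> : h g = 0 by rewrite subr0.
    apply/eqP; apply: contra_notT gK => hg; apply: hK.
    exact: subset_closure.
  split; (split; first by split => //; exists M => g; case: (fM' g));
    by move=> e /v [K cK vK]; exists K => // g /vK [].
move=> [[[cr [M fM]] vr] [[ci [N fN]] vi]].
have cf : continuous f by apply/continuous_complexP.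
have nf g r : `|complex.Re (f g)| + `|complex.Im (f g)| <= r -> `|f g| <= r%:C%C.
  by rewrite [in X in _ -> X]fE; exact: normc_le_add.
split; first by split => //; exists (M + N) => g; apply: nf; exact: lerD.
move=> e e0; have e2 : 0 < e / 2 by rewrite divr_gt0.
have [K cK fK] := vr _ e2; have [L cL fL] := vi _ e2.
have [u [U [cu u01 [_ KU] uU [csu _]]]] := @urysohn_lc R X
  (hausdorff_units hD) (lc_units hD) (K `|` L) setT (compactU cK cL) openT
  (@subsetT _ _).
have hE g : f g * (u (rg D g))%:C%C =
    (complex.Re (f g) * u (rg D g) +i* (complex.Im (f g) * u (rg D g)))%C.
  by case: (f g) => a b; simpc.
exists (fun g => f g * (u (rg D g))%:C%C), (closure [set x | u x != 0]); split.
- split.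
    apply/continuous_complexP; split => g /=.
      rewrite (_ : (fun _ => _) = (fun t => complex.Re (f t) * u (rg D t))).
        apply: cvgM; first exact: cr.
        by apply: continuous_comp; [exact: rg_continuous|exact: cu].
      by apply/funext => t; rewrite hE.
    rewrite (_ : (fun _ => _) = (fun t => complex.Im (f t) * u (rg D t))).
      apply: cvgM; first exact: ci.
      by apply: continuous_comp; [exact: rg_continuous|exact: cu].
    by apply/funext => t; rewrite hE.
  exists (M + N) => g; rewrite hE; apply: normc_le_add; rewrite !normrM.
  have /andP[? ?] := u01 (rg D g); rewrite (ger0_norm (x := u _))//.
  by apply: lerD; rewrite -[leRHS]mulr1; apply: ler_pM.
- exact: csu.
- have cl : closed (rg D @^-1` closure [set x | u x != 0]).
    apply: preimage_closed (@closed_closure _ _).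
    by move=> g _; exact: rg_continuous.
  rewrite [X in X `<=` _]closureE => g; apply; split => // h /= fh.
  apply: subset_closure => /=; apply: contraNneq fh => ->.
  by rewrite (_ : 0%:C%C = 0)// mulr0.
- move=> g; have -> : f g - f g * (u (rg D g))%:C%C =
    (complex.Re (f g) * (1 - u (rg D g)) +i* (complex.Im (f g) * (1 - u (rg D g))))%C.
    by rewrite hE {1}fE; simpc; rewrite !mulrBr !mulr1.
  have /andP[u0 u1] := u01 (rg D g); apply: normc_le_add; rewrite !normrM.
  rewrite (ger0_norm (x := 1 - _)) ?subr_ge0//.
  have [KL|/not_orP [/fK fk /fL fl]] := pselect ((K `|` L) (rg D g)).
    by rewrite uU ?subrr ?mulr0 ?addr0 ?ltW//; exact: KU.
  rewrite -mulrDl; apply: le_trans (_ : (e / 2 + e / 2) * 1 <= _); last lra.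
  by apply: ler_pM; [exact: addr_ge0|rewrite subr_ge0|exact: lerD|lra].
Qed.

End vanishing.
Arguments vanishing {R G X} D f.

(** * Characters as limits along filters on [G] *)

Section beta_functions.
Context {R : realType} {G X : topologicalType} {D : groupoid G X}.
Hypothesis hD : lc_groupoid D.
Local Notation A := (set_type (C0r R D)).
Local Notation B := (set_type (beta R D)).

Definition complex_fun (u v : G -> R) : G -> R[i]^o := fun g => (u g +i* v g)%C.

Lemma C0r_complex_fun u v : vanishing D u -> vanishing D v -> C0r R D (complex_fun u v).
Proof. by move=> vu vv; apply/(C0rP hD). Qed.

(** Total in [u] and [v], with value 0 when one of them is not [vanishing], so that no membership
    proof has to be passed. *)
Definition mkC0r (u v : G -> R) : A :=
  insubd (@exist _ (fun f => f \in C0r R D) _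
    (mem_set (C0r_complex_fun (vanishing0 (D := D)) (vanishing0 (D := D))))) (complex_fun u v).

Lemma val_mkC0r u v : vanishing D u -> vanishing D v ->
  val (mkC0r u v) = complex_fun u v.
Proof. by move=> vu vv; rewrite val_insubd mem_set//; exact: C0r_complex_fun. Qed.

Definition gelfand_real (phi : B) (f : G -> R) : R[i]^o := val phi (mkC0r f (cst 0)).

Lemma gelfandD (phi : B) (f g h : A) :
  val h = (fun x => val f x + val g x) -> val phi h = val phi f + val phi g.
Proof. by have [_ + _ _] := set_mem (valP phi); exact. Qed.

Lemma gelfandZ (phi : B) (c : R[i]) (f h : A) :
  val h = (fun x => c * val f x) -> val phi h = c * val phi f.
Proof. by have [_ _ + _] := set_mem (valP phi); exact. Qed.

Lemma gelfandM (phi : B) (f g h : A) :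
  val h = (fun x => val f x * val g x) -> val phi h = val phi f * val phi g.
Proof. by have [_ _ _ +] := set_mem (valP phi); exact. Qed.

Lemma gelfand_realD phi f g : vanishing D f -> vanishing D g ->
  gelfand_real phi (fun x => f x + g x) = gelfand_real phi f + gelfand_real phi g.
Proof.
move=> vf vg; apply: gelfandD; rewrite !val_mkC0r//; try exact: vanishing0.
  by apply/funext => x; rewrite /complex_fun /=; simpc.
exact: vanishingD.
Qed.

Lemma gelfand_realM phi f g : vanishing D f -> vanishing D g ->
  gelfand_real phi (fun x => f x * g x) = gelfand_real phi f * gelfand_real phi g.
Proof.
move=> vf vg; apply: gelfandM; rewrite !val_mkC0r//; try exact: vanishing0.
  by apply/funext => x; rewrite /complex_fun /=; simpc.
by apply: vanishingM => //; case: vg.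
Qed.

Lemma gelfand_realZ phi (r : R) f : vanishing D f ->
  gelfand_real phi (fun x => r * f x) = r%:C%C * gelfand_real phi f.
Proof.
move=> vf; apply: gelfandZ; rewrite !val_mkC0r//; try exact: vanishing0.
  by apply/funext => x; rewrite /complex_fun /=; simpc.
exact: vanishingZ.
Qed.

Lemma gelfand_real_parts phi (f : A) : val phi f =
  gelfand_real phi (fun g => complex.Re (val f g)) +
  'i%C * gelfand_real phi (fun g => complex.Im (val f g)).
Proof.
have [vr vi] := (C0rP hD _).1 (set_mem (valP f)).
have vii : val (mkC0r (cst 0) (fun g => complex.Im (val f g))) =
    (fun g => 'i%C * val (mkC0r (fun g => complex.Im (val f g)) (cst 0)) g).
  rewrite !val_mkC0r//; try exact: vanishing0.
  by apply/funext => x; rewrite /complex_fun /=; simpc.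
rewrite -(gelfandZ phi vii); apply: gelfandD.
rewrite !val_mkC0r//; try exact: vanishing0.
by apply/funext => x; rewrite /complex_fun /=; case: (val f x) => a b; simpc.
Qed.

Lemma gelfand_real_neq0 phi : exists2 f, vanishing D f & gelfand_real phi f != 0.
Proof.
have [[f phif] _ _ _] := set_mem (valP phi).
have [vr vi] := (C0rP hD _).1 (set_mem (valP f)).
have [r0|] := eqVneq (gelfand_real phi (fun g => complex.Re (val f g))) 0; last first.
  by exists (fun g => complex.Re (val f g)).
exists (fun g => complex.Im (val f g)) => //.
apply: contra phif => /eqP i0.
by rewrite -[X in X == _]/(val phi f) gelfand_real_parts r0 i0 mulr0 addr0.
Qed.

(* [phi] should be thought of as a limit of points of [G] along which the
   functions of [null_at phi] tend to 0. *)
Definition null_at (phi : B) (k : G -> R) := [/\ bounded_cont k,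
  forall g, 0 <= k g &
  forall h, vanishing D h -> gelfand_real phi (fun g => h g * k g) = 0].

Lemma null_atD phi k l : null_at phi k -> null_at phi l -> null_at phi (fun g => k g + l g).
Proof.
move=> [bk k0 nk] [bl l0 nl]; split.
- exact: bounded_contD.
- by move=> g; rewrite addr_ge0.
move=> h vh; rewrite (_ : (fun _ => _) = (fun g => h g * k g + h g * l g)).
  by rewrite gelfand_realD ?nk ?nl ?addr0//; exact: vanishingM.
by apply/funext => g; rewrite mulrDr.
Qed.

Lemma null_at0 phi : null_at phi (cst 0).
Proof.
split=> [|//|h vh]; first exact: bounded_cont_cst.
rewrite (_ : (fun _ => _) = (fun g => 0 * h g)); last first.
  by apply/funext => g; rewrite mulr0 mul0r.
by rewrite gelfand_realZ// mul0r.
Qed.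

(* With [c] the value of [phi] at [f], this function is [|f - c|^2]. *)
Lemma null_at_sqr phi f : vanishing D f -> null_at phi (fun g =>
  (f g - complex.Re (gelfand_real phi f)) ^+ 2 + complex.Im (gelfand_real phi f) ^+ 2).
Proof.
case lE : (gelfand_real phi f) => [a b] /= vf; have [bf _] := vf.
have bc r := @bounded_cont_cst R G r.
have bk : bounded_cont (fun g => (f g - a) ^+ 2 + b ^+ 2).
  apply: (bounded_contD _ (bc _)); apply: bounded_contM;
    exact: (bounded_contD bf (bc _)).
split => // [g|h vh]; first by rewrite addr_ge0 ?sqr_ge0.
have vhf := vanishingM vh bf; have vhff := vanishingM vhf bf.
rewrite (_ : (fun _ => _) = (fun g => h g * f g * f g +
    ((- (2 * a)) * (h g * f g) + (a ^+ 2 + b ^+ 2) * h g))); last first.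
  by apply/funext => g; ring.
rewrite !gelfand_realD ?gelfand_realZ ?gelfand_realM//; try exact: vanishingZ; last first.
  by apply: vanishingD; exact: vanishingZ.
rewrite lE; case: (gelfand_real phi h) => c d.
by simpc; congr (_ +i* _)%C; ring.
Qed.

(* Otherwise [1 / k] is bounded, so that every vanishing [u] is [(u / k) * k],
   on which [phi] is 0. *)
Lemma null_at_lt phi k e : null_at phi k -> 0 < e -> exists g, k g < e.
Proof.
move=> [[ck [M kM]] k0 nk] e0; apply: contrapT => /forallNP ke.
have {}ke g : e <= k g by rewrite leNgt; exact/negP.
have kn g : k g != 0 by rewrite gt_eqF// (lt_le_trans e0).
have [u vu /eqP[]] := gelfand_real_neq0 phi.
have bi : bounded_cont (fun g => (k g)^-1).
  split; first by move=> g; apply: cvgV; [exact: kn|exact: ck].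
  exists e^-1 => g; rewrite normfV ger0_norm// lef_pV2 ?posrE//.
  exact: lt_le_trans (ke g).
rewrite (_ : u = (fun g => u g * (k g)^-1 * k g)); first by rewrite nk//; exact: vanishingM.
by apply/funext => g; rewrite mulfVK.
Qed.

(** Plays the part of the trace on [G] of the neighbourhoods of [phi]. A sum of two null functions
    serves for intersections, and [null_at_lt] makes the filter proper. *)
Definition beta_filter (phi : B) : set_system G :=
  [set U | exists k e, [/\ null_at phi k, 0 < e & forall g, k g < e -> U g]].

#[global] Instance beta_filter_proper phi : ProperFilter (beta_filter phi).
Proof.
apply: Build_ProperFilter_ex.
  move=> U [k [e [nk e0 kU]]]; have [g gk] := null_at_lt nk e0.
  by exists g; exact: kU.
split.
- by exists (cst 0), 1; split => //; exact: null_at0.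
- move=> U V [k [e [nk e0 kU]]] [l [d [nl d0 lV]]].
  exists (fun g => k g + l g), (Num.min e d); split; first exact: null_atD.
    by rewrite lt_min e0.
  move=> g; rewrite lt_min => /andP[kle kld].
  have [_ k0 _] := nk; have [_ l0 _] := nl.
  have := k0 g; have := l0 g => ? ?.
  by split; [apply: kU; lra|apply: lV; lra].
- move=> U V UV [k [e [nk e0 kU]]]; exists k, e; split => // g /kU.
  exact: UV.
Qed.

(* The value of [phi] at a real function; junk unless [f] is [vanishing]. *)
Definition bev (phi : B) (f : G -> R) : R := complex.Re (gelfand_real phi f).

(** If the imaginary part [b] of the value were nonzero, the null function [(f - a)^2 + b^2] would
    stay above [b^2], against [null_at_lt]. *)
Lemma gelfand_realE phi f : vanishing D f -> gelfand_real phi f = (bev phi f)%:C%C.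
Proof.
move=> vf; suff i0 : complex.Im (gelfand_real phi f) = 0.
  by rewrite /bev; case: (gelfand_real phi f) i0 => a b /= ->.
apply/eqP; apply: contrapT => /negP i0.
have i2 : 0 < complex.Im (gelfand_real phi f) ^+ 2 by rewrite exprn_even_gt0.
have [g] := null_at_lt (null_at_sqr phi vf) i2.
by rewrite gtrDr ltNge sqr_ge0.
Qed.

Lemma bev_cvg phi f : vanishing D f -> f @ beta_filter phi --> bev phi f.
Proof.
move=> vf; apply/cvgrPdist_lt => e e0.
exists (fun g => (f g - complex.Re (gelfand_real phi f)) ^+ 2 +
    complex.Im (gelfand_real phi f) ^+ 2),
  (e ^+ 2); split; [exact: null_at_sqr|by rewrite exprn_gt0|].
move=> g; rewrite gelfand_realE//= expr0n addr0 => fe.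
by rewrite distrC -(ltr_pXn2r (n := 2)) ?nnegrE ?(ltW e0)// real_normK ?num_real.
Qed.

Lemma gelfandE phi (f : A) : val phi f =
  (bev phi (fun g => complex.Re (val f g)) +i*
   bev phi (fun g => complex.Im (val f g)))%C.
Proof.
have [vr vi] := (C0rP hD _).1 (set_mem (valP f)).
by rewrite gelfand_real_parts !gelfand_realE//; simpc.
Qed.

Lemma bev_inj phi psi : (forall f, vanishing D f -> bev phi f = bev psi f) ->
  phi = psi.
Proof.
move=> e; apply: val_inj; apply/funext => f.
have [vr vi] := (C0rP hD _).1 (set_mem (valP f)).
by rewrite -[LHS]/(val phi f) -[RHS]/(val psi f) !gelfandE !e.
Qed.

Lemma bev_neq0 phi : exists2 f, vanishing D f & bev phi f != 0.
Proof.
have [f vf f0] := gelfand_real_neq0 phi; exists f => //.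
by apply: contra f0 => /eqP f0; rewrite gelfand_realE// f0.
Qed.

(** Source of the points of the spectrum constructed below: algebraic identities survive limits, and
    the last hypothesis excludes the zero functional. *)
Lemma bev_limit (F : set_system G) (l : (G -> R) -> R) : ProperFilter F ->
  (forall f, vanishing D f -> f @ F --> l f) ->
  (exists2 f, vanishing D f & l f != 0) ->
  exists phi : B, forall f, vanishing D f -> bev phi f = l f.
Proof.
move=> FF lF [f0 vf0 lf0].
pose phi (f : A) : R[i]^o := (l (fun g => complex.Re (val f g)) +i*
   l (fun g => complex.Im (val f g)))%C.
have lF' (f : A) : val f @ F --> phi f.
  have [vr vi] := (C0rP hD _).1 (set_mem (valP f)).
  by apply/cvg_complexP; split; exact: lF.
have uniq (u : G -> R[i]^o) (a b : R[i]^o) : u @ F --> a -> u @ F --> b -> a = b.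
  by move=> ua ub; exact: (cvg_unique (complex_hausdorff (R := R)) ua ub).
have phi_mk f : vanishing D f -> phi (mkC0r f (cst 0)) = (l f)%:C%C.
  move=> vf; apply: uniq (lF' _) _; rewrite val_mkC0r//; last exact: vanishing0.
  by apply/cvg_complexP; split; [exact: lF|exact: cvg_cst].
have phiP : beta R D phi.
  split.
  - exists (mkC0r f0 (cst 0)); rewrite phi_mk//.
    by apply: contra lf0; rewrite eq_complex => /andP[/=].
  - move=> f g h E; apply: uniq (lF' h) _; rewrite E.
    by apply: cvgD; exact: lF'.
  - move=> c f h E; apply: uniq (lF' h) _; rewrite E.
    by apply: cvgM; [exact: cvg_cst|exact: lF'].
  - move=> f g h E; apply: uniq (lF' h) _; rewrite E.
    by apply: cvgM; exact: lF'.
exists (exist _ phi (mem_set phiP)) => f vf.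
by rewrite /bev (_ : gelfand_real _ f = phi (mkC0r f (cst 0)))// phi_mk.
Qed.

End beta_functions.

Arguments bev_cvg {R G X D} hD phi [f] _.

(** * The topology of the spectrum *)

Lemma ultra_cvg (T : Type) (U : topologicalType) (F : set_system T)
    (f : T -> U) (K : set U) : UltraFilter F -> compact K -> F (f @^-1` K) ->
  exists2 l, K l & f @ F --> l.
Proof.
move=> FU cK FK; have [l [Kl cl]] := cK (f @ F) _ FK.
exists l => // V lV; have [//|FnV] := in_ultra_setVsetC (f @^-1` V) FU.
by have [u [nV Vu]] := cl (~` V) V FnV lV.
Qed.

Section beta_topology.
Context {R : realType} {G X : topologicalType} {D : groupoid G X}.
Hypothesis hD : lc_groupoid D.
Local Notation A := (set_type (C0r R D)).
Local Notation B := (set_type (beta R D)).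
Local Notation bev := (bev hD).
Local Notation beta_filter := (beta_filter hD).

Lemma cvg_beta (I : Type) (F : set_system I) (u : I -> B) (phi : B) :
  Filter F ->
  (forall f, vanishing D f -> (fun i => bev (u i) f) @ F --> bev phi f) ->
  u @ F --> phi.
Proof.
move=> FF uf; apply: cvg_subtype; apply/cvg_sup => f.
move=> U [_ [[V oV <-] /= Vf VU]].
have [vr vi] := (C0rP hD _).1 (set_mem (valP f)).
have c : (fun i => val (u i) f) @ F --> (val phi f : R[i]^o).
  rewrite (gelfandE hD); apply/cvg_complexP.
  split.
    rewrite (_ : (fun _ => _) = (fun i => bev (u i) (fun g => complex.Re (val f g)))).
      exact: uf.
    by apply/funext => i; rewrite (gelfandE hD).
  rewrite (_ : (fun _ => _) = (fun i => bev (u i) (fun g => complex.Im (val f g)))).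
    exact: uf.
  by apply/funext => i; rewrite (gelfandE hD).
have FV : F (fun i => V (val (u i) f)) by exact: c V (open_nbhs_nbhs (conj oV Vf)).
by apply: (@filterS _ F _ _ _ _ FV) => i Vi; exact: VU.
Qed.

Lemma bev_continuous f : vanishing D f -> continuous (fun phi : B => bev phi f).
Proof.
move=> vf phi.
have cv : continuous (fun psi : B => val psi (mkC0r hD f (cst 0)) : R[i]^o).
  move=> psi; apply: (@continuous_comp B {ptws A -> R[i]^o} R[i]^o val
    (fun h => h (mkC0r hD f (cst 0)))); first exact: val_subtype_continuous.
  exact: (@proj_continuous A (fun _ => R[i]^o) (mkC0r hD f (cst 0))).
by have /continuous_complexP [+ _] := cv; exact.
Qed.

Lemma hausdorff_beta : hausdorff_space B.
Proof.
apply: hausdorff_subtype.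
apply: (@hausdorff_product A (fun _ => R[i]^o)) => _.
exact: complex_hausdorff.
Qed.

Lemma bev_bounded f (M : R) phi : vanishing D f -> (forall g, `|f g| <= M) ->
  `|bev phi f| <= M.
Proof.
move=> vf fM; have fl := bev_cvg hD phi vf.
rewrite ler_norml; apply/andP; split.
  apply: (closed_cvg _ (@closed_ge _ (- M)) _ _ fl).
  by apply: nearW => g /=; have := fM g; rewrite ler_norml => /andP[].
apply: (closed_cvg _ (@closed_le _ M) _ _ fl).
by apply: nearW => g /=; have := fM g; rewrite ler_norml => /andP[].
Qed.

(** Along an ultrafilter the bounded values [bev phi h] all converge. Their limits form a character,
    which is nonzero because the bound [c <= bev phi f] passes to the limit. *)
Lemma compact_beta f (c : R) : vanishing D f -> 0 < c ->
  compact [set phi : B | c <= bev phi f].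
Proof.
move=> vf c0; rewrite compact_ultra => F FU Fc.
have /choice [l lP] : forall h : G -> R, exists l : R, vanishing D h ->
    (fun phi => bev phi h) @ F --> l.
  move=> h; have [vh|nvh] := pselect (vanishing D h); last by exists 0.
  have [[_ [M hM]] _] := vh.
  have [] := @ultra_cvg _ _ F (fun phi => bev phi h) `[- M, M] FU (@segment_compact _ _ _).
    apply: filterE => phi /=; rewrite in_itv /= -ler_norml.
    exact: bev_bounded.
  by move=> x _ hx; exists x.
(* [Q] brings [F] down to [G]: the iterated limits [l] become limits along a single filter on [G],
   as [bev_limit] requires. *)
pose Q : set_system G := [set V | \forall phi \near F, beta_filter phi V].
have QQ : ProperFilter Q.
  apply: Build_ProperFilter_ex.
    move=> V QV; have [phi phiV] := filter_ex (F := F) QV.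
    exact: filter_ex phiV.
  split.
  - by apply: (filterE (F := F)) => phi; exact: filterT.
  - by move=> V W; apply: (filterS2 (F := F)) => phi; exact: filterI.
  - by move=> V W VW; apply: (filterS (F := F)) => phi; exact: filterS.
have lQ h : vanishing D h -> h @ Q --> l h.
  move=> vh; apply/cvgrPdist_lt => e e0; have e2 : 0 < e / 2 by rewrite divr_gt0.
  have /cvgrPdist_lt /(_ _ e2) := lP h vh; rewrite /Q; apply: filterS => phi lphi.
  have /cvgrPdist_lt /(_ _ e2) := bev_cvg hD phi vh.
  apply: filterS => g bg; rewrite (_ : l h - h g = (l h - bev phi h) + (bev phi h - h g)).
    by apply: le_lt_trans (ler_normD _ _) _; lra.
  by lra.
have cl : c <= l f.
  exact: (closed_cvg _ (@closed_ge _ c) Fc _ (lP f vf)).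
have [|phi phiE] := bev_limit hD QQ lQ.
  by exists f => //; rewrite gt_eqF// (lt_le_trans c0).
exists phi; split; first by rewrite /= phiE.
by apply: cvg_beta => h vh; rewrite phiE//; exact: lP.
Qed.

Lemma bevM (phi : B) (f g : G -> R) : vanishing D f -> vanishing D g ->
  bev phi (fun x => f x * g x) = bev phi f * bev phi g.
Proof.
move=> vf vg; have vfg : vanishing D (fun x => f x * g x).
  by apply: vanishingM => //; case: vg.
apply: (@complexI R); transitivity (gelfand_real hD phi f * gelfand_real hD phi g).
  by rewrite -gelfand_realM// gelfand_realE.
by rewrite !gelfand_realE// -rmorphM.
Qed.

Lemma bev_gt0 (phi : B) : exists2 f, vanishing D f & 0 < bev phi f.
Proof.
have [f vf f0] := bev_neq0 hD phi; exists (fun x => f x * f x).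
  by apply: vanishingM => //; case: vf.
by rewrite bevM// -expr2 lt_def sqrf_eq0 f0 sqr_ge0.
Qed.

Lemma lc_beta : locally_compact [set: B].
Proof.
move=> phi _; have [f vf f0] := bev_gt0 phi.
have f2 : 0 < bev phi f / 2 by rewrite divr_gt0.
exists [set psi | bev phi f / 2 <= bev psi f]; last first.
  split; first exact: compact_beta.
  apply: (@preimage_closed B R (fun psi => bev psi f)) (@closed_ge R _).
  by move=> psi _; exact: bev_continuous.
have /cvgrPdist_lt /(_ _ f2) := @bev_continuous f vf phi.
apply: filterS => psi; rewrite ltr_norml => /andP[_ lt] _ /=; lra.
Qed.

Lemma beta_pt_subproof g : exists phi : B, forall f, vanishing D f -> bev phi f = f g.
Proof.
have gg : [set g] g by [].
apply: (@bev_limit _ _ _ _ hD (globally [set g]) (fun f => f g)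
  (globally_properfilter gg)).
  by move=> f _ U /nbhs_singleton Uf; rewrite /nbhs /= /globally /= => _ ->.
(* Evaluation at [g] is not the zero functional: a cutoff on [X] that is 1 at [rg D g] pulls back to
   a function with value 1 at [g]. *)
have [u [U [cu _ [_ gU] uU [csu _]]]] := @urysohn_lc R X
  (hausdorff_units hD) (lc_units hD) [set rg D g] setT (@compact_set1 _ _) openT
  (@subsetT _ _).
exists (fun h => u (rg D h)); first exact: vanishing_comp_rg.
by rewrite uU ?oner_eq0//; exact: gU.
Qed.

Definition beta_pt (g : G) : B := projT1 (cid (beta_pt_subproof g)).

Lemma bev_beta_pt g f : vanishing D f -> bev (beta_pt g) f = f g.
Proof. by move=> vf; rewrite /beta_pt; case: cid => phi /= ->. Qed.

Lemma beta_pt_continuous : continuous beta_pt.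
Proof.
move=> g; apply: cvg_beta => f vf; rewrite bev_beta_pt//.
rewrite (_ : (fun _ => _) = f); first by case: vf => -[cf _] _; exact: cf.
by apply/funext => h; rewrite bev_beta_pt.
Qed.

Lemma cvg_beta_pt (phi : B) : beta_pt @ beta_filter phi --> phi.
Proof.
apply: cvg_beta => f vf; rewrite (_ : (fun _ => _) = f); first exact: bev_cvg.
by apply/funext => h; rewrite bev_beta_pt.
Qed.

Lemma beta_atP (g : G) (phi : B) : beta_at g phi <-> phi = beta_pt g.
Proof.
split=> [gphi|-> f].
  apply: (bev_inj (hD := hD)) => f vf; rewrite bev_beta_pt//.
  apply: (@complexI R); rewrite -(gelfand_realE hD)// /gelfand_real gphi val_mkC0r//.
  exact: vanishing0.
have [vr vi] := (C0rP hD _).1 (set_mem (valP f)).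
by rewrite (gelfandE hD) !bev_beta_pt//; case: (val f g).
Qed.

Section extend.
Context {Y : topologicalType} (F : G -> Y).
Hypothesis hY : hausdorff_space Y.
Hypothesis lY : locally_compact [set: Y].
Hypothesis vF : forall f : Y -> R, continuous f ->
  compact (closure [set y | f y != 0]) -> vanishing D (fun g => f (F g)).
Hypothesis KF : forall phi : B, exists2 K, compact K & beta_filter phi (F @^-1` K).

(** [KF] provides a cluster point [y] of [F] along the filter of [phi]. For a cutoff [f] at [y], the
    function [f (F g)] has a limit, which must be the value 1 taken near [y]; so [F] is eventually
    in the support of [f], hence converges to [y]. Testing with cutoffs at [Phi phi] gives
    continuity. *)
Lemma beta_extend : exists2 Phi : B -> Y, continuous Phi &
  forall phi : B, F @ beta_filter phi --> Phi phi.
Proof.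
have /choice [Phi PhiF] : forall phi : B, exists y : Y, F @ beta_filter phi --> y.
  move=> phi; have [K cK FK] := KF phi.
  have [y [Ky cl]] := cK (F @ beta_filter phi) _ FK.
  exists y => U yU.
  have [f [N [cf f01 [oN yN] fN [csf sfU]]]] := @urysohn_lc R Y hY lY [set y] U°
    (@compact_set1 _ _) (@open_interior _ _) (fun z zy => eq_ind_r U° yU zy).
  have vf := vF cf csf; have := bev_cvg hD phi vf.
  set l := bev _ _ => fl.
  have l1 : l = 1.
    apply/eqP; apply: contrapT => /negP/eqP/eqP; rewrite -subr_eq0 -normr_gt0 => e0.
    move/cvgrPdist_lt : fl => /(_ _ e0) fl.
    have FV : beta_filter phi (F @^-1` [set z | `|l - f z| < `|l - 1|]) by [].
    have [z [/= lz Nz]] := cl _ _ FV (open_nbhs_nbhs (conj oN (yN y erefl))).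
    by move: lz; rewrite fN// ltxx.
  move/cvgrPdist_lt : fl => /(_ 1 ltr01); apply: filterS => g; rewrite l1 => fg.
  apply: (@interior_subset _ U); apply: sfU; apply: subset_closure => /=.
  by apply: contraTneq fg => ->; rewrite subr0 normr1 ltxx.
exists Phi => // phi U phiU.
have [f [N [cf f01 [oN yN] fN [csf sfU]]]] := @urysohn_lc R Y hY lY [set Phi phi] U°
  (@compact_set1 _ _) (@open_interior _ _) (fun z zy => eq_ind_r U° phiU zy).
have vf := vF cf csf.
have bE psi : bev psi (fun g => f (F g)) = f (Phi psi).
  apply: (cvg_unique (@norm_hausdorff _ R^o) (bev_cvg hD psi vf)).
  by apply: (cvg_comp _ _ (PhiF psi)); exact: cf.
have /cvgrPdist_lt /(_ 1 ltr01) := @bev_continuous _ vf phi.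
apply: filterS => psi; rewrite !bE fN; last exact: yN.
move=> fpsi; apply: (@interior_subset _ U); apply: sfU; apply: subset_closure => /=.
by apply: contraTneq fpsi => ->; rewrite subr0 normr1 ltxx.
Qed.
End extend.

End beta_topology.

Arguments bev_continuous {R G X D} hD [f] _.
Arguments cvg_beta_pt {R G X D} hD phi.
Arguments beta_pt_continuous {R G X D} hD.

(** * The action on the spectrum *)

Lemma lc_separates (R : realType) (Y : topologicalType) (x y : Y) :
  hausdorff_space Y -> locally_compact [set: Y] ->
  (forall f : Y -> R, continuous f -> compact (closure [set z | f z != 0]) ->
    f x = f y) -> x = y.
Proof.
move=> hY lY fxy; apply: contrapT => xy.
have clx : closed [set y].
  exact/accessible_closed_set1/hausdorff_accessible.
have [f [N [cf _ [_ Nx] fN [csf sf]]]] := @urysohn_lc R Y hY lY [set x] (~` [set y])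
  (@compact_set1 _ _) (closed_openC clx) (fun z zx zy => xy (etrans (esym zx) zy)).
have := fxy f cf csf; rewrite fN; last exact: Nx.
move=> fy; have : (~` [set y]) y; last by apply.
by apply: sf; apply: subset_closure; rewrite /= -fy oner_eq0.
Qed.

(** * Translation along local sections *)

Section patches.
Context {R : realType} {G X : topologicalType} {D : groupoid G X}.
Hypothesis hD : lc_groupoid D.

(** Multiplying by [e] extends functions defined over the range of [q.2] to all of [G], and changes
    nothing over [N]. *)
Definition patch (q : (X -> G) * set G) (e : X -> R) (N : set X) :=
  [/\ local_section D q, continuous e,
     compact (closure [set x | e x != 0]),
     closure [set x | e x != 0] `<=` rg D @` q.2 &
     open N /\ forall x, N x -> e x = 1].

Lemma patch_ex (k : G) : etale D ->
  exists q e N, [/\ patch q e N, q.2 k & N (rg D k)].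
Proof.
move=> hE; have [q lq qk] := etale_section k hE; have [oq _ _] := lq.
have [e [N [ce e01 [oN kN] eN [cse seq]]]] := @urysohn_lc R X
  (hausdorff_units hD) (lc_units hD) [set rg D k] (rg D @` q.2)
  (@compact_set1 _ _) (rg_open hD oq)
  (fun x xk => eq_ind_r (rg D @` q.2) (ex_intro2 _ _ k qk erefl) xk).
by exists q, e, N; split => //; exact: kN.
Qed.

(* Left translation by an element [k^-1] with [k] in the bisection [q.2], cut off
   by [e] so as to be defined on all of [G]. *)
Definition patch_translate (q : (X -> G) * set G) (e : X -> R) (f : G -> R) (h : G) : R :=
  e (rg D h) * f (mul D (inv D (q.1 (rg D h))) h).

Lemma local_section_near (q : (X -> G) * set G) k : local_section D q -> q.2 k ->
  \forall x \near rg D k, q.2 (q.1 x) /\ rg D (q.1 x) = x.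
Proof.
move=> [oq qE _] qk.
have : nbhs (rg D k) (rg D @` q.2).
  by apply: open_nbhs_nbhs; split; [exact: rg_open|exists k].
by apply: filterS => _ [h qh <-]; rewrite qE.
Qed.

(** Over the support of [e] the factor [f] is continuous and bounded; off this support the product
    is 0 on a neighbourhood. *)
Lemma vanishing_cutoff (e : X -> R) (U : set X) (f : G -> R) (M : R) :
  continuous e -> compact (closure [set x | e x != 0]) ->
  closure [set x | e x != 0] `<=` U ->
  (forall h, U (rg D h) -> {for h, continuous f}) ->
  (forall h, U (rg D h) -> `|f h| <= M) ->
  vanishing D (fun h => e (rg D h) * f h).
Proof.
move=> ce cse seU cf fM; have [L L0 eL] := compact_support_bounded ce cse.
have e0 x : ~ closure [set x | e x != 0] x -> e x = 0.
  by move=> Sx; apply/eqP; apply: contra_notT Sx => ?; exact: subset_closure.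
split; last first.
  move=> d d0; exists (closure [set x | e x != 0]) => // h /e0 ->.
  by rewrite mul0r normr0 ltW.
split; last first.
  exists (L * `|M|) => h; rewrite normrM.
  have [Uh|nU] := pselect (U (rg D h)).
    by apply: ler_pM => //; apply: le_trans (fM _ Uh) (ler_norm _).
  by rewrite e0 ?normr0 ?mul0r ?mulr_ge0// => /seU.
move=> h; have [Uh|nU] := pselect (U (rg D h)).
  apply: (@cvgM _ _ (nbhs h)); last exact: cf.
  by apply: continuous_comp; [exact: rg_continuous|exact: ce].
have n0 : \forall h' \near h, e (rg D h') * f h' = 0.
  have oS : open (~` closure [set x | e x != 0]) by exact/closed_openC/closed_closure.
  have Sh : (~` closure [set x | e x != 0]) (rg D h) by move=> /seU.
  have := @rg_continuous _ _ _ hD h _ (open_nbhs_nbhs (conj oS Sh)).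
  by rewrite /= /nbhs /=; apply: filterS => h' /= /e0 ->; rewrite mul0r.
rewrite /continuous_at (nbhs_singleton n0).
by apply: (@cvg_near_cst _ _ _ _ (nbhs h)).
Qed.

Lemma vanishing_patch q e N f : patch q e N -> vanishing D f ->
  vanishing D (patch_translate q e f).
Proof.
move=> [lq ce cse seq _] [[cf [M fM]] _]; have [oq qE qc] := lq.
apply: (vanishing_cutoff (M := M) ce cse seq) => // h [k qk kh].
apply: (cvg_comp (fun h' => mul D (inv D (q.1 (rg D h'))) h') f _ (cf _)).
have nr : \forall h' \near h, q.2 (q.1 (rg D h')) /\ rg D (q.1 (rg D h')) = rg D h'.
  have := local_section_near lq qk; rewrite kh.
  by move=> /(@rg_continuous _ _ _ hD h).
apply: (@within_cvg2 _ (nbhs h) _ _ _ _ (mul D)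
  (fun h' => inv D (q.1 (rg D h'))) id _ _ _ (mul_continuous hD)).
- by have [_ /= rh] := nbhs_singleton nr; rewrite /= sc_inv rh.
- apply: (@continuous_comp _ _ _ (fun h' => q.1 (rg D h')) (inv D));
    last exact: inv_continuous.
  apply: (@continuous_comp _ _ _ (rg D) q.1); first exact: rg_continuous.
  by rewrite -kh; exact: qc.
- exact: cvg_id.
- by apply: filterS nr => h' [_ /= rh]; rewrite /= sc_inv rh.
Qed.

End patches.
Arguments patch {R G X} D q e N.
Arguments patch_translate {R G X} D q e f h.

(** * The extension of the range map *)

Section beta_anchor.
Context {R : realType} {G X : topologicalType} {D : groupoid G X}.
Hypothesis hD : lc_groupoid D.
Local Notation B := (set_type (beta R D)).

Lemma beta_anchor_ex : exists2 p : B -> X, continuous p &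
  forall phi : B, rg D @ beta_filter hD phi --> p phi.
Proof.
apply: (beta_extend (hausdorff_units hD) (lc_units hD)).
  by move=> f cf csf; exact: vanishing_comp_rg.
(* Along [phi], [f] eventually exceeds half its limit, while it is at most that over the complement
   of a compact [K]; hence [rg D] is eventually in [K]. *)
move=> phi; have [f vf f0] := bev_gt0 hD phi.
have f2 : 0 < bev hD phi f / 2 by rewrite divr_gt0.
have [_ /(_ _ f2) [K cK fK]] := vf.
exists K => //; have /cvgrPdist_lt /(_ _ f2) := bev_cvg hD phi vf.
apply: filterS => g; rewrite ltr_norml => /andP[_ lt] /=.
apply: contrapT => /fK; apply/negP; rewrite -ltNge.
by apply: lt_le_trans (ler_norm _); lra.
Qed.

Definition beta_anchor : B -> X := sval (cid2 beta_anchor_ex).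

Lemma beta_anchor_continuous : continuous beta_anchor.
Proof. by rewrite /beta_anchor; case: cid2. Qed.

Lemma beta_anchor_cvg (phi : B) : rg D @ beta_filter hD phi --> beta_anchor phi.
Proof. by rewrite /beta_anchor; case: cid2. Qed.

Lemma bev_comp_rg (phi : B) (f : X -> R) : continuous f ->
  compact (closure [set x | f x != 0]) ->
  bev hD phi (fun g => f (rg D g)) = f (beta_anchor phi).
Proof.
move=> cf csf.
apply: (cvg_unique (@norm_hausdorff _ R^o)
  (bev_cvg hD phi (vanishing_comp_rg hD cf csf))).
by apply: (cvg_comp _ _ (@beta_anchor_cvg phi)); exact: cf.
Qed.

Lemma beta_rg_anchor : beta_rg beta_anchor.
Proof.
move=> f h phi [cf _] hE.
have hc : val h @ beta_filter hD phi --> (val phi h : R[i]^o).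
  have [vr vi] := (C0rP hD _).1 (set_mem (valP h)).
  by rewrite (gelfandE hD); apply/cvg_complexP; split; exact: bev_cvg.
apply: (cvg_unique (complex_hausdorff (R := R)) hc); rewrite hE.
by apply: (cvg_comp _ _ (@beta_anchor_cvg phi)); exact: cf.
Qed.

Lemma beta_rg_unique (p : B -> X) : beta_rg p -> p = beta_anchor.
Proof.
move=> pP; apply/funext => phi.
apply: (lc_separates (R := R) (hausdorff_units hD) (lc_units hD)) => f cf csf.
have vf := vanishing_comp_rg hD cf csf.
rewrite -bev_comp_rg//; apply: (@complexI R); rewrite -(gelfand_realE hD)//.
have v0 : vanishing D (cst (0 : R)) by exact: vanishing0.
apply/esym; apply: (pP (fun x => (f x)%:C%C)); last by rewrite val_mkC0r.
split.
  by apply/continuous_complexP; split; [exact: cf|exact: cst_continuous].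
move=> e e0; exists (closure [set x | f x != 0]) => // x fx.
rewrite (_ : f x = 0) ?normr0 ?ler0c ?ltW//.
by apply/eqP; apply: contra_notT fx => ?; exact: subset_closure.
Qed.

Lemma beta_anchor_pt g : beta_anchor (beta_pt hD g) = rg D g.
Proof.
apply: (lc_separates (R := R) (hausdorff_units hD) (lc_units hD)) => f cf csf.
by rewrite -bev_comp_rg// bev_beta_pt//; exact: vanishing_comp_rg.
Qed.

(** With a cutoff [u] equal to 1 on [K], the preimage of [K] is closed in the set where the pullback
    of [u] is at least 1, which is compact by [compact_beta]. *)
Lemma beta_anchor_proper : proper_map beta_anchor.
Proof.
move=> K cK.
have [u [U [cu _ [_ KU] uU [csu _]]]] := @urysohn_lc R X
  (hausdorff_units hD) (lc_units hD) K setT cK openT (@subsetT _ _).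
have cB := compact_beta (hD := hD) (vanishing_comp_rg hD cu csu) (@ltr01 R).
apply: subclosed_compact cB _.
  apply: (@preimage_closed B X beta_anchor).
    by move=> phi _; exact: beta_anchor_continuous.
  by apply: compact_closed => //; exact: (hausdorff_units hD).
move=> phi /= Kphi; rewrite bev_comp_rg//.
by rewrite uU ?lexx//; exact: KU.
Qed.

End beta_anchor.

(** * The extension of left translation *)

Section beta_action.
Context {R : realType} {G X : topologicalType} {D : groupoid G X}.
Hypotheses (hD : lc_groupoid D) (hE : etale D).
Local Notation B := (set_type (beta R D)).
Local Notation p := (beta_anchor (R := R) hD).
Local Notation at_beta phi := (beta_filter hD phi).

Lemma near_rg (phi : B) (U : set X) : nbhs (p phi) U ->
  \forall h \near at_beta phi, U (rg D h).
Proof. exact: beta_anchor_cvg. Qed.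

Lemma local_section_lim (phi : B) q k : local_section D q -> q.2 k -> rg D k = p phi ->
  [/\ (fun h => q.1 (rg D h)) @ at_beta phi --> k,
      \forall h \near at_beta phi, q.2 (q.1 (rg D h)) &
      \forall h \near at_beta phi, rg D (q.1 (rg D h)) = rg D h].
Proof.
move=> lq qk kp; have := local_section_near hD lq qk; rewrite kp => /near_rg nq.
have [_ qE qc] := lq; split; [|by apply: filterS nq => h []|by apply: filterS nq => h []].
rewrite -[X in _ --> X](qE _ qk) kp.
apply: (cvg_comp _ _ (@beta_anchor_cvg _ _ _ _ hD phi)).
by rewrite -kp; exact: qc.
Qed.

(** The limit depends on [k] only: a field [t] tending to [k] enters the open set [q.2], where
    arrows are determined by their ranges. This is how etaleness makes the translate of [phi] well
    defined. *)
Lemma patch_translate_cvg (phi : B) q e N k (t : G -> G) f : patch D q e N -> q.2 k ->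
  rg D k = p phi -> N (p phi) -> vanishing D f ->
  t @ at_beta phi --> k -> (\forall h \near at_beta phi, rg D (t h) = rg D h) ->
  (fun h => f (mul D (inv D (t h)) h)) @ at_beta phi --> bev hD phi (patch_translate D q e f).
Proof.
move=> qP qk kp Np vf tk tr; have [[oq qE qc] _ _ _ [oN N1]] := qP.
apply: cvg_trans (bev_cvg hD phi (vanishing_patch hD qP vf)).
apply: near_eq_cvg.
have nN := near_rg (open_nbhs_nbhs (conj oN Np)).
have nq : \forall h \near at_beta phi, q.2 (t h).
  exact: tk (open_nbhs_nbhs (conj oq qk)).
near=> h; rewrite /patch_translate.
have -> : q.1 (rg D h) = t h.
  have <- : rg D (t h) = rg D h by near: h.
  by rewrite qE//; near: h.
by rewrite N1 ?mul1r//; near: h.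
Unshelve. all: by end_near. Qed.

(* [psi] is [g phi]: along [phi], [h |-> (t h)^-1] is a field of arrows composable
   with [h] that tends to [g]. *)
Definition translates (g : G) (phi psi : B) := forall (t : G -> G) (f : G -> R),
  vanishing D f -> t @ at_beta phi --> inv D g ->
  (\forall h \near at_beta phi, rg D (t h) = rg D h) ->
  (fun h => f (mul D (inv D (t h)) h)) @ at_beta phi --> bev hD psi f.

Lemma translates_ex (g : G) (phi : B) : sc D g = p phi -> exists psi, translates g phi psi.
Proof.
move=> gp; have rk : rg D (inv D g) = p phi by rewrite rg_inv.
have [q [e [N [qP qk Nk]]]] := patch_ex (R := R) hD (inv D g) hE.
rewrite rk in Nk; have [lq _ _ _ _] := qP.
have [qk' _ qr] := local_section_lim lq qk rk.
pose t h := q.1 (rg D h).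
have Tc f : vanishing D f -> f @ ((fun h => mul D (inv D (t h)) h) @ at_beta phi) -->
    bev hD phi (patch_translate D q e f).
  by move=> vf; exact: (patch_translate_cvg qP qk rk Nk vf qk' qr).
have [|psi psiE] := bev_limit hD _ Tc.
  have [u [U [cu _ [_ gU] uU [csu _]]]] := @urysohn_lc R X
    (hausdorff_units hD) (lc_units hD) [set rg D g] setT (@compact_set1 _ _) openT
    (@subsetT _ _).
  have vu := vanishing_comp_rg hD cu csu.
  (* The limit functional is nonzero: the translated arrows have range [sc D (t h)], which tends to
     [rg D g], where [u] is 1. *)
  exists (fun h => u (rg D h)) => //.
  suff -> : bev hD phi (patch_translate D q e (fun h => u (rg D h))) = 1.
    exact: oner_neq0.
  apply: (cvg_unique (@norm_hausdorff _ R^o) (Tc _ vu)).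
  rewrite -(uU (rg D g)); last exact: gU.
  apply: (cvg_comp (fun h => rg D (mul D (inv D (t h)) h)) u (G := nbhs (rg D g)));
    last exact: cu.
  rewrite -[rg D g](sc_inv D).
  apply: (@cvg_trans _ ((fun h => sc D (t h)) @ at_beta phi)).
    apply: near_eq_cvg; apply: filterS qr => h rh.
    by rewrite rg_mul ?rg_inv ?sc_inv.
  by apply: (cvg_comp _ _ qk'); exact: sc_continuous.
exists psi => s f vf sk sr; rewrite psiE//.
exact: (patch_translate_cvg qP qk rk Nk vf sk sr).
Qed.

Definition beta_act (g : G) (phi : B) : B := xget phi [set psi | translates g phi psi].

Lemma beta_actP g phi : sc D g = p phi -> translates g phi (beta_act g phi).
Proof.
move=> gp; rewrite /beta_act; case: xgetP => [psi _ //|nt].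
by have [psi /nt] := translates_ex gp.
Qed.

(** On a patch the action is dual to one operation on functions that does not depend on [g]; joint
    continuity and associativity both rest on this. *)
Lemma bev_beta_act g (phi : B) q e N f : patch D q e N -> q.2 (inv D g) ->
  sc D g = p phi -> N (p phi) -> vanishing D f ->
  bev hD (beta_act g phi) f = bev hD phi (patch_translate D q e f).
Proof.
move=> qP qk gp Np vf; have [lq _ _ _ _] := qP.
have rk : rg D (inv D g) = p phi by rewrite rg_inv.
have [qk' _ qr] := local_section_lim lq qk rk.
apply: (cvg_unique (@norm_hausdorff _ R^o) ((beta_actP gp : translates _ _ _) _ _ vf qk' qr)).
exact: (patch_translate_cvg qP qk rk Np vf qk' qr).
Qed.

Lemma beta_act_p g phi : sc D g = p phi -> p (beta_act g phi) = rg D g.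
Proof.
move=> gp; have rk : rg D (inv D g) = p phi by rewrite rg_inv.
have [q lq qk] := etale_section (inv D g) hE.
have [qk' _ qr] := local_section_lim lq qk rk.
apply: (lc_separates (R := R) (hausdorff_units hD) (lc_units hD)) => f cf csf.
rewrite -bev_comp_rg//.
apply: (cvg_unique (@norm_hausdorff _ R^o)
  ((beta_actP gp : translates _ _ _) _ _ (vanishing_comp_rg hD cf csf) qk' qr)).
rewrite -(sc_inv D).
apply: (@cvg_trans _ ((fun h => f (sc D (q.1 (rg D h)))) @ at_beta phi)).
  apply: near_eq_cvg; apply: filterS qr => h rh.
  by rewrite rg_mul ?rg_inv ?sc_inv.
apply: (cvg_comp (fun h => sc D (q.1 (rg D h))) f); last exact: cf.
by apply: (cvg_comp _ _ qk'); exact: sc_continuous.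
Qed.

Lemma beta_act1 phi : beta_act (un D (p phi)) phi = phi.
Proof.
apply: (bev_inj (hD := hD)) => f vf.
have gp : sc D (un D (p phi)) = p phi by rewrite sc_un.
have uk : (fun h => un D (rg D h)) @ at_beta phi --> inv D (un D (p phi)).
  rewrite inv_un; apply: (cvg_comp _ _ (@beta_anchor_cvg _ _ _ _ hD phi)).
  exact: un_continuous.
apply: (cvg_unique (@norm_hausdorff _ R^o) ((beta_actP gp : translates _ _ _) _ _ vf uk _)).
  by apply: filterE => h; rewrite rg_un.
rewrite (_ : (fun _ => _) = f); first exact: bev_cvg.
by apply/funext => h; rewrite inv_un mul1g.
Qed.

Lemma inv_mul (g h : G) : sc D g = rg D h ->
  inv D (mul D g h) = mul D (inv D h) (inv D g).
Proof.
move=> gh; set b := mul D (inv D h) (inv D g).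
have rb : rg D b = sc D h by rewrite rg_mul ?rg_inv ?sc_inv.
have ab : mul D (mul D g h) b = un D (rg D g).
  by rewrite -mulgA ?rb// mulKg ?rg_inv// mulgV.
have -> : b = mul D (inv D (mul D g h)) (mul D (mul D g h) b).
  by rewrite mulgK// sc_mul.
by rewrite ab -(rg_mul gh) -sc_inv mulg1.
Qed.

Lemma beta_actM g h phi : sc D g = rg D h -> sc D h = p phi ->
  beta_act (mul D g h) phi = beta_act g (beta_act h phi).
Proof.
move=> gh hp; apply: (bev_inj (hD := hD)) => f vf.
have [q [e [N [qP qk Nk]]]] := patch_ex (R := R) hD (inv D g) hE.
rewrite rg_inv in Nk; have [lq _ _ _ [oN N1]] := qP; have [_ _ qc] := lq.
have php := beta_act_p hp.
rewrite (bev_beta_act qP qk _ _ vf); last 2 first.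
- by rewrite php.
- by rewrite php -gh.
have rk : rg D (inv D h) = p phi by rewrite rg_inv.
have [s ls sk] := etale_section (inv D h) hE.
have [sk' _ sr] := local_section_lim ls sk rk.
have ghp : sc D (mul D g h) = p phi by rewrite sc_mul.
(* A field tending to [inv D (mul D g h)]: an arrow near [inv D h] with the range of [x], times an
   arrow near [inv D g] whose range is the source of the former. *)
pose t x := mul D (s.1 (rg D x)) (q.1 (sc D (s.1 (rg D x)))).
have scs : (fun x => sc D (s.1 (rg D x))) @ at_beta phi --> rg D (inv D g).
  rewrite rg_inv gh -(sc_inv D h).
  by apply: (cvg_comp _ _ sk'); exact: sc_continuous.
have qscs : (fun x => q.1 (sc D (s.1 (rg D x)))) @ at_beta phi --> inv D g.
  have [_ qE _] := lq; rewrite -(qE _ qk).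
  apply: (cvg_comp (fun x => sc D (s.1 (rg D x))) q.1 scs).
  exact: qc.
have rq : \forall x \near at_beta phi,
    rg D (q.1 (sc D (s.1 (rg D x)))) = sc D (s.1 (rg D x)).
  have := local_section_near hD lq qk => nq.
  have := scs _ nq; rewrite /nbhs /=; apply: filterS.
  by move=> x [].
have tk : t @ at_beta phi --> inv D (mul D g h).
  rewrite inv_mul//.
  apply: (@within_cvg2 _ (at_beta phi) _ _ _ _ (mul D)
      (fun x => s.1 (rg D x)) (fun x => q.1 (sc D (s.1 (rg D x)))) _ _ _
      (mul_continuous hD)) => //=.
    by rewrite sc_inv rg_inv.
  by apply: filterS rq => x /= ->.
have tr : \forall x \near at_beta phi, rg D (t x) = rg D x.
  by apply: filterS2 rq sr => x rqx srx; rewrite /t rg_mul.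
apply: (cvg_unique (@norm_hausdorff _ R^o)
  ((beta_actP ghp : translates _ _ _) _ _ vf tk tr)).
have vT := vanishing_patch hD qP vf.
apply: cvg_trans ((beta_actP hp : translates _ _ _) _ _ vT sk' sr).
apply: near_eq_cvg.
have nN : \forall x \near at_beta phi, N (sc D (s.1 (rg D x))).
  by apply: scs; rewrite rg_inv; exact: open_nbhs_nbhs.
near=> x.
have srx : rg D (s.1 (rg D x)) = rg D x by near: x.
have rqx : rg D (q.1 (sc D (s.1 (rg D x)))) = sc D (s.1 (rg D x)) by near: x.
rewrite /patch_translate rg_mul ?rg_inv ?sc_inv//.
rewrite N1 ?mul1r; last by near: x.
rewrite /t inv_mul// mulgA ?sc_inv ?rg_inv//.
Unshelve. all: by end_near. Qed.

Definition beta_action : action D p :=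
  Action beta_act_p beta_act1 beta_actM.

Lemma beta_action_translation : extends_translation beta_action.
Proof.
move=> g h phi gh /(beta_atP hD) ->; apply/(beta_atP hD).
apply: (bev_inj (hD := hD)) => f vf; rewrite bev_beta_pt//.
have [q [e [N [qP qk Nk]]]] := patch_ex (R := R) hD (inv D g) hE.
have rk : rg D (inv D g) = rg D h by rewrite rg_inv.
have [[_ qE _] _ _ _ [_ N1]] := qP; rewrite rk in Nk.
have vT := vanishing_patch hD qP vf.
rewrite (bev_beta_act qP qk _ _ vf) ?beta_anchor_pt//.
by rewrite bev_beta_pt// /patch_translate N1// mul1r -rk qE// invgK.
Qed.

Lemma beta_gspace : lc_gspace beta_action.
Proof.
split; [exact: hausdorff_beta|exact: (lc_beta hD)|exact: beta_anchor_continuous|].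
apply/subspace_continuousP => -[g0 phi0] /= gp0.
apply: (cvg_beta (hD := hD)) => f vf.
have [q [e [N [qP qk Nk]]]] := patch_ex (R := R) hD (inv D g0) hE.
have [[oq qE _] _ _ _ [oN N1]] := qP.
have vT := vanishing_patch hD qP vf.
rewrite rg_inv gp0 in Nk.
rewrite (bev_beta_act qP qk gp0 Nk vf).
apply: (@cvg_trans _ ((fun gy : G * B => bev hD gy.2 (patch_translate D q e f)) @
  within [set gy | sc D gy.1 = p gy.2] (nbhs (g0, phi0)))).
  apply: near_eq_cvg.
  have n1 : \forall gy \near (g0, phi0), q.2 (inv D gy.1).
    have : nbhs g0 (inv D @^-1` q.2).
      exact: (@inv_continuous _ _ _ hD g0 _ (open_nbhs_nbhs (conj oq qk))).
    by move/(@cvg_fst _ _ (nbhs g0) (nbhs phi0) _).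
  have n2 : \forall gy \near (g0, phi0), N (p gy.2).
    have : nbhs phi0 (p @^-1` N).
      exact: (@beta_anchor_continuous _ _ _ _ hD phi0 _ (open_nbhs_nbhs (conj oN Nk))).
    by move/(@cvg_snd _ _ (nbhs g0) (nbhs phi0) _).
  rewrite /within /=; apply: filterS2 n1 n2 => -[g phi] /= qg Np gp.
  by rewrite (bev_beta_act qP qg gp Np vf).
apply: (@cvg_comp _ _ _ snd (fun phi => bev hD phi (patch_translate D q e f)) _ (nbhs phi0)).
  move=> U Uy; have : nbhs (g0, phi0) (snd @^-1` U) by exact: cvg_snd.
  by apply: filterS => z ? ?.
exact: bev_continuous.
Qed.

End beta_action.

(** * Pulling back densities to the spectrum *)

Section equivariant_extension.
Context {R : realType} {G X : topologicalType} {D : groupoid G X}.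
Hypotheses (hD : lc_groupoid D) (hE : etale D).
Context {Y : topologicalType} {p : Y -> X} {a : action D p} {q : X -> Y}.
Hypotheses (ha : lc_gspace a) (pp : proper_map p).
Hypotheses (cq : continuous q) (qK : forall x, p (q x) = x).
Local Notation B := (set_type (beta R D)).
Local Notation at_beta phi := (beta_filter hD phi).

Let orbit (g : G) : Y := act a g (q (sc D g)).

Lemma orbit_p g : p (orbit g) = rg D g.
Proof. by rewrite act_p// qK. Qed.

Lemma act_within (I : Type) (F : set_system I) (u : I -> G) (v : I -> Y) g y :
  Filter F -> sc D g = p y -> u @ F --> g -> v @ F --> y ->
  (\forall i \near F, sc D (u i) = p (v i)) ->
  (fun i => act a (u i) (v i)) @ F --> act a g y.
Proof.
move=> FF gy ug vy uv; case: ha => _ _ _ ca.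
exact: (@within_cvg2 _ F _ _ _ _ (act a) u v g y _ ca).
Qed.

Lemma orbit_continuous : continuous orbit.
Proof.
move=> g; apply: (@act_within _ (nbhs g) id (fun h => q (sc D h))).
- by rewrite qK.
- exact: cvg_id.
- by apply: (cvg_comp _ _ (@sc_continuous _ _ _ hD g)); exact: cq.
- by apply: filterE => h; rewrite qK.
Qed.

(** The anchor of [orbit g] is [rg D g], so the function is 0 except over the image in [X] of the
    support of [f], which is compact. *)
Lemma vanishing_orbit (f : Y -> R) : continuous f ->
  compact (closure [set y | f y != 0]) -> vanishing D (fun g => f (orbit g)).
Proof.
move=> cf csf; have [_ _ cp _] := ha.
have [M M0 fM] := compact_support_bounded cf csf; split.
  split; last by exists M => g.
  by move=> g; apply: (cvg_comp _ _ (@orbit_continuous g)); exact: cf.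
move=> e e0; exists (p @` closure [set y | f y != 0]).
  by apply: continuous_compact => //; exact: continuous_subspaceT.
move=> g ng; rewrite (_ : f (orbit g) = 0) ?normr0 ?ltW//.
apply/eqP; apply: contra_notT ng => fg; exists (orbit g); last exact: orbit_p.
exact: subset_closure.
Qed.

Lemma orbit_extension : exists Phi : B -> Y, [/\ continuous Phi,
  forall phi, p (Phi phi) = beta_anchor hD phi &
  forall g phi, sc D g = beta_anchor hD phi ->
    Phi (beta_act hD g phi) = act a g (Phi phi)].
Proof.
have [hY lY cp _] := ha.
(* Properness of [p] enters here: over a compact neighbourhood of the anchor of [phi], the orbit map
   stays in a compact set. *)
have KF (phi : B) : exists2 K, compact K & at_beta phi (orbit @^-1` K).
  have [W pW [cW _]] := lc_nbhs (beta_anchor hD phi) (lc_units hD).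
  exists (p @^-1` W); first exact: pp.
  have := near_rg pW; apply: filterS => g Wg /=.
  by rewrite orbit_p.
have [Phi cPhi PhiF] := beta_extend hY lY vanishing_orbit KF.
have pPhi phi : p (Phi phi) = beta_anchor hD phi.
  have c1 : (fun g => p (orbit g)) @ at_beta phi --> p (Phi phi).
    by apply: (cvg_comp _ _ (PhiF phi)); exact: cp.
  apply: (cvg_unique (hausdorff_units hD) c1).
  rewrite (_ : (fun _ => _) = rg D); first exact: beta_anchor_cvg.
  by apply/funext => g; rewrite orbit_p.
exists Phi; split => // g phi gp.
apply: (lc_separates (R := R) hY lY) => f cf csf; have vf := vanishing_orbit cf csf.
have bE psi : bev hD psi (fun g => f (orbit g)) = f (Phi psi).
  apply: (cvg_unique (@norm_hausdorff _ R^o) (bev_cvg hD psi vf)).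
  by apply: (cvg_comp _ _ (PhiF psi)); exact: cf.
rewrite -bE; have rk : rg D (inv D g) = beta_anchor hD phi by rewrite rg_inv.
have [s ls sk] := etale_section (inv D g) hE.
have [sk' _ sr] := local_section_lim ls sk rk.
apply: (cvg_unique (@norm_hausdorff _ R^o)
  ((beta_actP hE gp : translates _ _ _ _) _ _ vf sk' sr)).
(* Equivariance on [G] is associativity of the action; it passes to the limit along the filter of
   [phi]. *)
have orbitM h h' : sc D h = rg D h' -> orbit (mul D h h') = act a h (orbit h').
  by move=> hh; rewrite /orbit sc_mul// actM// qK.
apply: (@cvg_trans _ ((fun h => f (act a (inv D (s.1 (rg D h))) (orbit h))) @ at_beta phi)).
  apply: near_eq_cvg; apply: filterS sr => h rh.
  by rewrite orbitM// sc_inv.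
apply: (cvg_comp (fun h => act a (inv D (s.1 (rg D h))) (orbit h)) f); last exact: cf.
apply: act_within => //.
- by rewrite pPhi.
- rewrite -[X in _ --> X](invgK D).
  by apply: (cvg_comp _ _ sk'); exact: inv_continuous.
- by apply: filterS sr => h rh; rewrite sc_inv orbit_p.
Qed.

End equivariant_extension.

(** The fibres over [z] and [Phi z] consist of the same arrows of [D], so the sums for [z] are those
    for [Phi z]. *)
Lemma reiter_pullback (R : realType) (G X Y Z : topologicalType)
    (D : groupoid G X) (p : Y -> X) (a : action D p) (p' : Z -> X)
    (a' : action D p') (Phi : Z -> Y) :
  continuous Phi -> (forall z, p (Phi z) = p' z) ->
  (forall g z, sc D g = p' z -> Phi (act a' g z) = act a g (Phi z)) ->
  reiter R a -> reiter R a'.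
Proof.
move=> cPhi pPhi aPhi ra L e cL e0; have [w [wc w0 w1 wi]] := ra L e cL e0.
exists (fun z g => w (Phi z) g); split.
- apply/subspace_continuousP => -[z0 g0] /= zg0.
  have FF : Filter (within (crossed_set D p') (nbhs (z0, g0))) by exact: within_filter.
  apply: (@within_cvg2 _ (within (crossed_set D p') (nbhs (z0, g0))) _ _ _ _ w
    (fun zg => Phi zg.1) snd _ _ FF wc).
  + by rewrite /crossed_set /= pPhi.
  + apply: (@cvg_comp _ _ _ fst Phi _ (nbhs z0)); last exact: cPhi.
    move=> U Uy; have : nbhs (z0, g0) (fst @^-1` U) by exact: cvg_fst.
    by apply: filterS => t ? ?.
  + move=> U Uy; have : nbhs (z0, g0) (snd @^-1` U) by exact: cvg_snd.
    by apply: filterS => t ? ?.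
  + by apply: (filterE (F := nbhs (z0, g0))) => -[z g]; rewrite /crossed_set /= pPhi.
- by move=> z g.
- by move=> z; rewrite -pPhi.
- move=> z g Lg gz; have gPhi : rg D g = p (Phi z) by rewrite pPhi.
  by rewrite aPhi ?sc_inv//; exact: wi.
Qed.

Theorem strongly_amenable_beta_amenable (R : realType) (G X : topologicalType)
    (D : groupoid G X) : lc_groupoid D -> etale D ->
  strongly_amenable_at_infinity R D -> beta_amenable R D.
Proof.
move=> hD hE [Y [p [a [[ha ama] _ pp _ [q [cq qK]]]]]].
exists (beta_anchor hD), (beta_action hD hE); split.
- exact: beta_rg_anchor.
- exact: beta_action_translation.
split; first exact: beta_gspace.
apply: (reiter_amenable hD hE (beta_gspace hD hE)).
have [Phi [cPhi pPhi aPhi]] := orbit_extension (R := R) hD hE ha pp cq qK.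
apply: (reiter_pullback (a' := beta_action hD hE) cPhi pPhi aPhi).
exact: (amenable_reiter hD hE ha pp).
Qed.

(** * The second countable quotient *)

(** The second hypothesis expresses in terms of filters that the [S i] form a subbase; their finite
    intersections, indexed by lists, are a countable base. *)
Lemma countable_subbase (T : topologicalType) (I : countType) (S : I -> set T) :
  (forall i, open (S i)) ->
  (forall (t : T) (F : set_system T), Filter F ->
    (forall i, S i t -> F (S i)) -> F --> t) ->
  @second_countable T.
Proof.
move=> oS cvS; pose B (s : seq I) : set T := [set t | forall i, i \in s -> S i t].
exists (range B); first exact: sub_countable (card_image_le _ _) (countableP _).
split=> [_ [s _ <-]|t].
  elim: s => [|i s ih].
    rewrite (_ : B [::] = setT); first exact: openT.
    by apply/seteqP; split.
  rewrite (_ : B (i :: s) = S i `&` B s); first exact: openI.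
  apply/seteqP; split=> u /=.
    by move=> Bu; split=> [|j js]; apply: Bu; rewrite inE ?eqxx ?js ?orbT.
  by move=> [Su Bu] j; rewrite inE => /orP[/eqP ->|/Bu].
apply: cvS.
  apply: filter_from_filter.
    by exists (B [::]); split => //; exists [::].
  move=> _ _ [[r _ <-] Bt] [[s _ <-] Bt'].
  exists (B (r ++ s)); first split; first by exists (r ++ s).
    by move=> i; rewrite mem_cat => /orP[/Bt|/Bt'].
  by move=> u Bu; split=> i ir; apply: Bu; rewrite mem_cat ir ?orbT.
move=> i Sit; exists (B [:: i]).
  by split; [exists [:: i]|move=> j; rewrite inE => /eqP ->].
by move=> u Bu; apply: Bu; rewrite inE.
Qed.

Lemma real_open_rat (R : realType) (x : R) (U : set R) : nbhs x U ->
  exists a b : rat, ratr a < x < ratr b /\ forall y : R, ratr a < y < ratr b -> U y.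
Proof.
move=> /nbhs_ballP [e /= e0 xU].
have xe : x - e < x by lra.
have ex : x < x + e by lra.
have [a] := rat_in_itvoo xe; have [b] := rat_in_itvoo ex.
rewrite !in_itv /= => /andP[xb be] /andP[ea ax].
exists a, b; split=> [|y /andP[ay yb]]; first by rewrite ax.
by apply: xU; rewrite /ball /= ltr_norml; apply/andP; split; lra.
Qed.

Lemma second_countable_prod_seq (R : realType) (X : topologicalType)
    (J : countType) (A : set (X * {ptws J -> R})) :
  @second_countable X -> @second_countable A.
Proof.
move=> [B /countable_injP[f finj] [oB bB]].
pose S (i : nat + J * (rat * rat)) : set A := match i with
  | inl n => [set y | exists U, [/\ B U, f U = n & U (val y).1]]
  | inr (j, (a, b)) => [set y | ratr a < (val y).2 j < ratr b]
  end.
have c1 : continuous (fun y : A => (val y).1).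
  move=> y; apply: (@continuous_comp A (X * {ptws J -> R})%type X val fst y).
    exact: val_subtype_continuous.
  exact: cvg_fst.
have c2 j : continuous (fun y : A => (val y).2 j).
  move=> y; apply: (@continuous_comp A {ptws J -> R} R (fun y : A => (val y).2)
    (fun h => h j)); last exact: (@proj_continuous J (fun _ => R) j).
  apply: (@continuous_comp A (X * {ptws J -> R})%type {ptws J -> R} val snd y).
    exact: val_subtype_continuous.
  exact: cvg_snd.
apply: (@countable_subbase _ _ S).
  move=> [n|[j [a b]]] /=.
    rewrite (_ : [set y | _] = \bigcup_(U in [set U | B U /\ f U = n])
      ((fun y : A => (val y).1) @^-1` U)).
      apply: bigcup_open => U [/oB oU _]; apply: open_comp => // y _; exact: c1.
    by apply/seteqP; split=> y [U]; [move=> [BU fU Uy]|move=> [BU fU] Uy]; exists U.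
  rewrite (_ : [set y | _] = (fun y : A => (val y).2 j) @^-1`
      [set r : R | ratr a < r < ratr b]) //.
  apply: open_comp; first by move=> y _; exact: c2.
  rewrite (_ : [set r | _] = `]ratr a, ratr b[%classic); first exact: interval_open.
  by apply/seteqP; split=> r /=; rewrite in_itv.
move=> y F FF SF.
have F1 : (fun z : A => (val z).1) @ F --> (val y).1.
  move=> U /bB [V [BV Vy] VU].
  have : F (S (inl (f V))) by apply: SF; exists V.
  apply: (filterS (F := F)) => z [W [BW fW Wz]]; apply: VU.
  suff -> : V = W by [].
  by apply: finj; rewrite ?inE.
have F2 : (fun z : A => (val z).2) @ F --> (val y).2.
  apply/cvg_sup => j U [_ [[V oV <-] /= Vy VU]].
  have [a [b [aby abV]]] := real_open_rat (open_nbhs_nbhs (conj oV Vy)).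
  have : F (S (inr (j, (a, b)))) by exact: SF.
  by apply: (filterS (F := F)) => z /abV; exact: VU.
apply: cvg_subtype => U; rewrite [X in nbhs X U]surjective_pairing.
move=> /(cvg_pair F1 F2); apply: (filterS (F := F)) => z.
by rewrite /= -surjective_pairing.
Qed.

Section countable_data.
Context {R : realType} {G X : topologicalType} {D : groupoid G X}.
Hypotheses (hD : lc_groupoid D) (hE : etale D).

Lemma countable_patches : exists (q : nat -> (X -> G) * set G) (e : nat -> X -> R)
    (N : nat -> set X), (forall k, patch D (q k) (e k) (N k)) /\
  forall g, exists k, (q k).2 g /\ N k (rg D g).
Proof.
pose I := {x : ((X -> G) * set G) * (X -> R) * set X | patch D x.1.1 x.1.2 x.2}.
have s0 : patch D (un D, set0) (cst (0 : R)) set0.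
  have cl0 : closure [set x | cst (0 : R) x != 0] `<=` (set0 : set X).
    by rewrite (_ : [set x | _] = set0) ?closure0// -subset0 => x /=; rewrite eqxx.
  split.
  - by split => //; exact: open0.
  - exact: cst_continuous.
  - exact: subclosed_compact (@closed_closure _ _) (@compact0 _) cl0.
  - by move=> x /cl0.
  - by split => //; exact: open0.
pose O (x : I) := (sval x).1.1.2 `&` rg D @^-1` (sval x).2.
have [|g|c cP] := @lindelof G I (exist _ (un D, set0, cst 0, set0) s0) O
  (second_countable_arrows hD).
- move=> x; have [[oq _ _] _ _ _ [oN _]] := svalP x; apply: openI => //.
  by apply: open_comp => // g _; exact: rg_continuous.
- have [q [e [N [P qg Ng]]]] := patch_ex (R := R) hD g hE.
  by exists (exist _ (q, e, N) P).
exists (fun k => (sval (c k)).1.1), (fun k => (sval (c k)).1.2), (fun k => (sval (c k)).2).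
split=> [k|g]; first exact: (svalP (c k)).
by have [k [? ?]] := cP g; exists k.
Qed.

Lemma countable_compacts : exists L : seq nat -> set G,
  (forall s, compact (L s)) /\ forall K, compact K -> exists s, K `<=` L s.
Proof.
pose I := {W : set G | compact W}.
have [|g|c cP] := @lindelof G I (exist _ set0 (@compact0 _)) (fun W => (sval W)°)
  (second_countable_arrows hD).
- by move=> W; exact: open_interior.
- by have [W gW [cW _]] := lc_nbhs g (lc_arrows hD); exists (exist _ W cW).
exists (fun s => \big[setU/set0]_(k <- s) sval (c k)); split.
  by move=> s; apply: bigsetU_compact => k _; exact: (svalP (c k)).
move=> K cK; apply: (@compact_ind _ _ (fun K => exists s,
  K `<=` \big[setU/set0]_(k <- s) sval (c k)) cK).
- by exists [::].
- by move=> A B AB [s Bs]; exists s; exact: subset_trans Bs.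
- move=> A B [s As] [t Bt]; exists (s ++ t); rewrite big_cat.
  by move=> g [/As|/Bt]; [left|right].
move=> g _; have [k gk] := cP g; exists (sval (c k)) => //.
by exists [:: k]; rewrite big_seq1.
Qed.

End countable_data.

(** * The quotient determined by countably many coordinates *)

Section factor.
Context {R : realType} {G X : topologicalType} {D : groupoid G X}.
Hypotheses (hD : lc_groupoid D) (hE : etale D).
Local Notation B := (set_type (beta R D)).
Local Notation p := (beta_anchor (R := R) hD).
Local Notation at_beta phi := (beta_filter hD phi).
Variable a : action D p.
Hypotheses (ha : lc_gspace a) (ta : extends_translation a).

Lemma act_beta_pt g h : sc D g = rg D h -> act a g (beta_pt hD h) = beta_pt hD (mul D g h).
Proof. by move=> gh; apply/(beta_atP hD); apply: ta => //; apply/(beta_atP hD). Qed.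

(** Counterpart of [bev_beta_act] for any continuous action extending translation: the formula holds
    on [G], and joint continuity carries it along the filter of [phi]. *)
Lemma bev_act_patch g (phi : B) q e N f : patch D q e N -> q.2 (inv D g) ->
  sc D g = p phi -> N (p phi) -> vanishing D f ->
  bev hD (act a g phi) f = bev hD phi (patch_translate D q e f).
Proof.
move=> qP qk gp Np vf; have [lq _ _ _ _] := qP.
have rk : rg D (inv D g) = p phi by rewrite rg_inv.
have [qk' _ qr] := local_section_lim lq qk rk.
have c1 : (fun h => act a (inv D (q.1 (rg D h))) (beta_pt hD h)) @ at_beta phi --> act a g phi.
  apply: (act_within ha _ gp).
  - rewrite -[X in _ --> X](invgK D).
    by apply: (cvg_comp _ _ qk'); exact: inv_continuous.
  - exact: cvg_beta_pt.
  - by apply: filterS qr => h rh; rewrite sc_inv rh beta_anchor_pt.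
have c2 := cvg_comp _ _ c1 (@bev_continuous _ _ _ _ hD f vf (act a g phi)).
apply: (cvg_unique (@norm_hausdorff _ R^o) c2).
apply: cvg_trans (patch_translate_cvg qP qk rk Np vf qk' qr).
apply: near_eq_cvg; apply: filterS qr => h rh /=.
by rewrite act_beta_pt ?sc_inv// bev_beta_pt.
Qed.

Section density_function.
Variables (q : (X -> G) * set G) (e : X -> R) (N : set X) (w : B -> G -> R).
Hypothesis qP : patch D q e N.
Hypothesis wc : {within crossed_set D p, continuous (fun yg => w yg.1 yg.2)}.
Hypothesis w0 : forall y g, 0 <= w y g.
Hypothesis w1 : forall y, \esum_(g in [set g | rg D g = p y]) (w y g)%:E = 1%E.

(** Cut off by [e], this is the restriction to [G] of [phi |-> w phi g], where [g] is the arrow of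
    [q.2] over the anchor of [phi]. *)
Definition density_along (h : G) : R :=
  e (rg D h) * w (beta_pt hD h) (q.1 (rg D h)).

Lemma density_le1 (phi : B) g : rg D g = p phi -> w phi g <= 1.
Proof.
move=> gp; rewrite -lee_fin -(w1 phi) -(esum_set1 (a := fun g => (w phi g)%:E)) ?lee_fin//.
by apply: esum_subset => [h|h ->//]; rewrite lee_fin.
Qed.

Lemma vanishing_density_along : vanishing D density_along.
Proof.
have [lq ce cse seq _] := qP; have [_ qE qc] := lq.
apply: (vanishing_cutoff (M := 1) hD ce cse seq) => h [k qk kh].
  have nr : \forall h' \near h, q.2 (q.1 (rg D h')) /\ rg D (q.1 (rg D h')) = rg D h'.
    have := local_section_near hD lq qk; rewrite kh.
    by move=> /(@rg_continuous _ _ _ hD h).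
  apply: (@within_cvg2 _ (nbhs h) _ _ _ _ w (beta_pt hD) (fun h' => q.1 (rg D h')) _ _ _ wc).
  - by have [_ /= rh] := nbhs_singleton nr; rewrite /crossed_set /= rh beta_anchor_pt.
  - exact: beta_pt_continuous.
  - apply: (@continuous_comp _ _ _ (rg D) q.1); first exact: rg_continuous.
    by rewrite -kh; exact: qc.
  - by apply: filterS nr => h' [_ /= rh]; rewrite /crossed_set /= rh beta_anchor_pt.
by rewrite ger0_norm// density_le1// beta_anchor_pt -kh qE.
Qed.

Lemma bev_density_along (phi : B) g : q.2 g -> rg D g = p phi -> N (p phi) ->
  bev hD phi density_along = w phi g.
Proof.
move=> qg gp Np; have [lq _ _ _ [oN N1]] := qP.
have [qg' _ qr] := local_section_lim lq qg gp.
apply: (cvg_unique (@norm_hausdorff _ R^o) (bev_cvg hD phi vanishing_density_along)).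
apply: (@cvg_trans _ ((fun h => w (beta_pt hD h) (q.1 (rg D h))) @ at_beta phi)).
  apply: near_eq_cvg; have nN := near_rg (open_nbhs_nbhs (conj oN Np)).
  by apply: filterS nN => h Nh; rewrite /density_along N1// mul1r.
apply: (@within_cvg2 _ (at_beta phi) _ _ _ _ w (beta_pt hD) (fun h => q.1 (rg D h)) _ _ _ wc) => //.
- exact: cvg_beta_pt.
- by apply: filterS qr => h rh; rewrite /crossed_set /= rh beta_anchor_pt.
Qed.

End density_function.

Variables (q : nat -> (X -> G) * set G) (e : nat -> X -> R) (N : nat -> set X).
Hypothesis qP : forall k, patch D (q k) (e k) (N k).
Hypothesis qcov : forall g, exists k, (q k).2 g /\ N k (rg D g).
Variables (I : countType) (w : I -> B -> G -> R).
Hypothesis wc : forall i, {within crossed_set D p, continuous (fun yg => w i yg.1 yg.2)}.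
Hypothesis w0 : forall i y g, 0 <= w i y g.
Hypothesis w1 : forall i y, \esum_(g in [set g | rg D g = p y]) (w i y g)%:E = 1%E.

Local Notation J := (seq nat * (I * nat))%type.

(* The smallest family containing the [density_along] and stable under
   translation along the patches. *)
Definition quot_coord (j : J) : G -> R :=
  foldr (fun k => patch_translate D (q k) (e k))
    (density_along (q j.2.2) (e j.2.2) (w j.2.1)) j.1.

Lemma vanishing_quot_coord j : vanishing D (quot_coord j).
Proof.
case: j => s [i k]; rewrite /quot_coord /=; elim: s => [|k' s ih] /=.
  exact: (vanishing_density_along (qP k) (@wc i) (w0 i) (w1 i)).
exact: vanishing_patch (qP k') ih.
Qed.

(** The anchor is kept as a coordinate, so that points with the same image are composable with the
    same arrows. *)
Definition quot_map (phi : B) : X * {ptws J -> R} := (p phi, fun j => bev hD phi (quot_coord j)).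

Local Notation Y := (set_type (range quot_map)).

Definition quot_pt (phi : B) : Y := exist _ (quot_map phi) (mem_set (imageT quot_map phi)).

Lemma quot_pt_surj (y : Y) : exists phi, quot_pt phi = y.
Proof. by have [phi _ E] := set_mem (valP y); exists phi; exact: val_inj. Qed.

(** A choice of preimages that need not be continuous; continuity of what is defined through it is
    read off from the coordinates. *)
Definition quot_lift (y : Y) : B := sval (cid (quot_pt_surj y)).

Lemma quot_liftK y : quot_pt (quot_lift y) = y.
Proof. by rewrite /quot_lift; case: cid. Qed.

Lemma quot_pt_continuous : continuous quot_pt.
Proof.
move=> phi; have F1 := @beta_anchor_continuous R _ _ _ hD phi.
have F2 : (fun psi => (quot_map psi).2) @ nbhs phi --> (quot_map phi).2.
  apply/cvg_sup => j U [_ [[V oV <-] /= Vj VU]].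
  have FV : nbhs phi (fun psi => V (bev hD psi (quot_coord j))) by
    exact: (@bev_continuous _ _ _ _ hD _ (vanishing_quot_coord j) phi V
      (open_nbhs_nbhs (conj oV Vj))).
  by apply: (@filterS _ _ (nbhs_filter phi) _ _ _ FV) => psi; exact: VU.
apply: (@cvg_subtype _ _ _ (nbhs phi) quot_pt (quot_pt phi) (nbhs_filter phi)).
have FP := @cvg_pair _ _ _ _ _ _ (nbhs_filter phi) _ _ _ _ F1 F2.
by move=> U /FP.
Qed.

Definition quot_anchor (y : Y) : X := (val y).1.

Lemma quot_anchor_continuous : continuous quot_anchor.
Proof.
move=> y; apply: (@continuous_comp Y (X * {ptws J -> R})%type X val fst y).
  exact: val_subtype_continuous.
exact: cvg_fst.
Qed.

Lemma quot_coord_continuous j : continuous (fun y : Y => (val y).2 j).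
Proof.
move=> y; apply: (@continuous_comp Y {ptws J -> R} R (fun y : Y => (val y).2)
  (fun h => h j)); last exact: (@proj_continuous J (fun _ => R) j).
apply: (@continuous_comp Y (X * {ptws J -> R})%type {ptws J -> R} val snd y).
  exact: val_subtype_continuous.
exact: cvg_snd.
Qed.

Lemma quot_anchor_lift y : p (quot_lift y) = quot_anchor y.
Proof. by rewrite -[in RHS](quot_liftK y). Qed.

Lemma quot_coord_lift y j : (val y).2 j = bev hD (quot_lift y) (quot_coord j).
Proof. by rewrite -[in LHS](quot_liftK y). Qed.

Lemma quot_anchor_proper : proper_map quot_anchor.
Proof.
move=> K cK.
have -> : quot_anchor @^-1` K = quot_pt @` (p @^-1` K).
  apply/seteqP; split=> [y Ky|_ [phi Kphi <-]//].
  by exists (quot_lift y); rewrite ?quot_liftK//= quot_anchor_lift.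
apply: continuous_compact; first exact: continuous_subspaceT quot_pt_continuous.
exact: beta_anchor_proper.
Qed.

Lemma lc_quot : locally_compact [set: Y].
Proof.
move=> y _; have [W yW [cW clW]] := lc_nbhs (quot_anchor y) (lc_units hD).
exists (quot_anchor @^-1` W).
  have FV : nbhs y (quot_anchor @^-1` W) by exact: (quot_anchor_continuous yW).
  by apply: (@filterS _ _ (nbhs_filter y) _ _ _ FV) => z ? _.
split; first exact: quot_anchor_proper.
by apply: preimage_closed clW; move=> z _; exact: quot_anchor_continuous.
Qed.

Lemma hausdorff_quot : hausdorff_space Y.
Proof.
apply/hausdorff_subtype/hausdorff_prod; first exact: (hausdorff_units hD).
by apply: (@hausdorff_product J (fun _ => R)) => _; exact: norm_hausdorff.
Qed.

Lemma second_countable_quot : @second_countable Y.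
Proof. exact/second_countable_prod_seq/(second_countable_units hD). Qed.

Lemma quot_pt_eq phi psi : p phi = p psi ->
  (forall j, bev hD phi (quot_coord j) = bev hD psi (quot_coord j)) -> quot_pt phi = quot_pt psi.
Proof.
move=> pe be; apply: val_inj; rewrite /= /quot_map pe; congr (_, _).
by apply/funext => j; exact: be.
Qed.

(** Acting by an arrow whose inverse lies in patch [k] prepends [k] to the word of a coordinate.
    This is why coordinates are indexed by words, and why the action descends to [Y]. *)
Lemma bev_act_coord g phi k s b : (q k).2 (inv D g) -> N k (rg D (inv D g)) ->
  sc D g = p phi ->
  bev hD (act a g phi) (quot_coord (s, b)) = bev hD phi (quot_coord (k :: s, b)).
Proof.
move=> qk Nk gp; apply: (bev_act_patch (qP k)) => //.
  by rewrite -gp -rg_inv.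
exact: vanishing_quot_coord.
Qed.

Lemma bev_density_coord i phi k g : (q k).2 g -> N k (rg D g) -> rg D g = p phi ->
  bev hD phi (quot_coord ([::], (i, k))) = w i phi g.
Proof.
move=> qk Nk gp.
by apply: (bev_density_along (qP k) (@wc i) (w0 i) (w1 i) qk gp); rewrite -gp.
Qed.

Lemma quot_pt_act g phi psi : sc D g = p phi -> quot_pt phi = quot_pt psi ->
  quot_pt (act a g phi) = quot_pt (act a g psi).
Proof.
move=> gp /(congr1 val) /= [pe be]; have gp' : sc D g = p psi by rewrite -pe.
apply: quot_pt_eq; first by rewrite !act_p.
move=> [s b]; have [k [qk Nk]] := qcov (inv D g).
by rewrite !(bev_act_coord _ _ qk Nk)//; exact: (congr1 (@^~ (k :: s, b)) be).
Qed.

(** On a patch containing [g], the density is itself a coordinate: the one with empty word. *)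
Lemma w_quot_pt i g phi psi : rg D g = p phi -> quot_pt phi = quot_pt psi ->
  w i phi g = w i psi g.
Proof.
move=> gp /(congr1 val) /= [pe be]; have gp' : rg D g = p psi by rewrite -pe.
have [k [qk Nk]] := qcov g.
rewrite -(bev_density_coord i qk Nk gp) -(bev_density_coord i qk Nk gp').
exact: (congr1 (@^~ ([::], (i, k))) be).
Qed.

Definition quot_act (g : G) (y : Y) : Y := quot_pt (act a g (quot_lift y)).

Lemma quot_actE g phi : sc D g = p phi ->
  quot_act g (quot_pt phi) = quot_pt (act a g phi).
Proof.
move=> gp; apply: quot_pt_act; last by rewrite quot_liftK.
by rewrite quot_anchor_lift.
Qed.

Lemma quot_act_p g y : sc D g = quot_anchor y -> quot_anchor (quot_act g y) = rg D g.
Proof. by move=> gy; rewrite /quot_anchor /= act_p// quot_anchor_lift. Qed.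

Lemma quot_act1 y : quot_act (un D (quot_anchor y)) y = y.
Proof. by rewrite /quot_act -quot_anchor_lift act1 quot_liftK. Qed.

Lemma quot_actM g h y : sc D g = rg D h -> sc D h = quot_anchor y ->
  quot_act (mul D g h) y = quot_act g (quot_act h y).
Proof.
move=> gh hy; have hp : sc D h = p (quot_lift y) by rewrite quot_anchor_lift.
rewrite -[quot_act h y]/(quot_pt (act a h (quot_lift y))) quot_actE ?act_p//.
by rewrite -actM.
Qed.

Definition quot_action : action D quot_anchor :=
  Action quot_act_p quot_act1 quot_actM.

Lemma quot_gspace : lc_gspace quot_action.
Proof.
split; [exact: hausdorff_quot|exact: lc_quot|exact: quot_anchor_continuous|].
apply/subspace_continuousP => -[g0 y0] /= gy0.
set W := within _ _.
have FW : Filter W by exact: within_filter.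
have W1 : (fun gy : G * Y => gy.1) @ W --> g0.
  move=> U Uy; have : nbhs (g0, y0) (fst @^-1` U) by exact: cvg_fst.
  by apply: filterS => t ? ?.
have W2 : (fun gy : G * Y => gy.2) @ W --> y0.
  move=> U Uy; have : nbhs (g0, y0) (snd @^-1` U) by exact: cvg_snd.
  by apply: filterS => t ? ?.
have WS : W [set gy | sc D gy.1 = quot_anchor gy.2] by exact: withinT.
have F1 : (fun gy : G * Y => (val (quot_act gy.1 gy.2)).1) @ W --> (val (quot_act g0 y0)).1.
  rewrite [X in _ --> X](quot_act_p gy0).
  apply: (@cvg_trans _ ((fun gy : G * Y => rg D gy.1) @ W)).
    apply: near_eq_cvg; apply: filterS WS => gy gyE.
    by rewrite -(quot_act_p gyE).
  by apply: (cvg_comp _ _ W1); exact: rg_continuous.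
have F2 : (fun gy : G * Y => (val (quot_act gy.1 gy.2)).2) @ W --> (val (quot_act g0 y0)).2.
  apply/cvg_sup => -[s b].
  have [k [qk Nk]] := qcov (inv D g0).
  have nk : W [set gy | (q k).2 (inv D gy.1) /\ N k (rg D (inv D gy.1))].
    have [[oq _ _] _ _ _ [oN _]] := qP k.
    have c1 : (fun gy : G * Y => inv D gy.1) @ W --> inv D g0.
      by apply: (cvg_comp _ _ W1); exact: inv_continuous.
    have c2 : (fun gy : G * Y => rg D (inv D gy.1)) @ W --> rg D (inv D g0).
      by apply: (cvg_comp _ _ c1); exact: rg_continuous.
    by apply: filterI; [exact: c1 (open_nbhs_nbhs (conj oq qk))
      |exact: c2 (open_nbhs_nbhs (conj oN Nk))].
  (* One patch [k] serves all arrows near [g0], so each coordinate of the translate is a fixed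
     coordinate of [y], independent of [g]. *)
  have E g y : sc D g = quot_anchor y -> (q k).2 (inv D g) -> N k (rg D (inv D g)) ->
      (val (quot_act g y)).2 (s, b) = (val y).2 (k :: s, b).
    move=> gy qg Ng; rewrite [RHS]quot_coord_lift.
    by rewrite -(bev_act_coord _ _ qg Ng)// quot_anchor_lift.
  have c : (fun gy : G * Y => (val (quot_act gy.1 gy.2)).2 (s, b)) @ W -->
      (val (quot_act g0 y0)).2 (s, b).
    rewrite E//; apply: (@cvg_trans _ ((fun gy : G * Y => (val gy.2).2 (k :: s, b)) @ W)).
      apply: near_eq_cvg; apply: filterS2 WS nk => gy gyE [? ?].
      by rewrite E.
    apply: (cvg_comp _ (fun y : Y => (val y).2 (k :: s, b)) W2).
    exact: quot_coord_continuous.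
  move=> U [_ [[V oV <-] /= Vj VU]].
  have := c V (open_nbhs_nbhs (conj oV Vj)).
  by apply: (filterS (F := W)) => gy; exact: VU.
by apply: cvg_subtype => U /(cvg_pair F1 F2); apply: (filterS (F := W)).
Qed.

Lemma quot_density_continuous i :
  {within crossed_set D quot_anchor, continuous (fun yg => w i (quot_lift yg.1) yg.2)}.
Proof.
apply/subspace_continuousP => -[y0 g0] /= yg0.
set W := within _ _.
have FW : Filter W by exact: within_filter.
have W1 : (fun yg : Y * G => yg.1) @ W --> y0.
  move=> U Uy; have : nbhs (y0, g0) (fst @^-1` U) by exact: cvg_fst.
  by apply: filterS => t ? ?.
have W2 : (fun yg : Y * G => yg.2) @ W --> g0.
  move=> U Uy; have : nbhs (y0, g0) (snd @^-1` U) by exact: cvg_snd.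
  by apply: filterS => t ? ?.
have WS : W [set yg | quot_anchor yg.1 = rg D yg.2] by exact: withinT.
have [k [qk Nk]] := qcov g0.
have nk : W [set yg | (q k).2 yg.2 /\ N k (rg D yg.2)].
  have [[oq _ _] _ _ _ [oN _]] := qP k.
  have c2 : (fun yg : Y * G => rg D yg.2) @ W --> rg D g0.
    by apply: (cvg_comp _ _ W2); exact: rg_continuous.
  by apply: filterI; [exact: W2 (open_nbhs_nbhs (conj oq qk))
    |exact: c2 (open_nbhs_nbhs (conj oN Nk))].
have E g y : quot_anchor y = rg D g -> (q k).2 g -> N k (rg D g) ->
    w i (quot_lift y) g = (val y).2 ([::], (i, k)).
  move=> gy qg Ng; rewrite quot_coord_lift (bev_density_coord i qg Ng)//.
  by rewrite quot_anchor_lift.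
rewrite [X in _ --> X](E g0 y0 yg0 qk Nk).
apply: (@cvg_trans _ ((fun yg : Y * G => (val yg.1).2 ([::], (i, k))) @ W)).
  apply: near_eq_cvg; apply: filterS2 WS nk => yg ygE [? ?].
  exact/esym/E.
apply: (cvg_comp _ (fun y : Y => (val y).2 ([::], (i, k))) W1).
exact: quot_coord_continuous.
Qed.

Lemma quot_section_continuous : continuous (fun x => quot_pt (beta_pt hD (un D x))).
Proof.
move=> x; apply: (cvg_comp (fun x => beta_pt hD (un D x)) quot_pt); last exact: quot_pt_continuous.
apply: (cvg_comp (un D) (beta_pt hD)); last exact: beta_pt_continuous.
exact: un_continuous.
Qed.

Lemma quot_sectionK x : quot_anchor (quot_pt (beta_pt hD (un D x))) = x.
Proof. by rewrite /quot_anchor /= beta_anchor_pt rg_un. Qed.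

Lemma quot_reiter :
  (forall (L : set G) (d : R), compact L -> 0 < d -> exists i,
    forall phi g, L g -> rg D g = p phi ->
      (\esum_(h in [set h | rg D h = rg D g])
        `|w i (act a (inv D g) phi) (mul D (inv D g) h) - w i phi h|%:E <= d%:E)%E) ->
  reiter R quot_action.
Proof.
move=> wi L d cL d0; have [i {}wi] := wi L d cL d0.
exists (fun y g => w i (quot_lift y) g); split => //.
- exact: quot_density_continuous.
- by move=> y; rewrite -quot_anchor_lift.
- move=> y g Lg gy; have gp : rg D g = p (quot_lift y) by rewrite quot_anchor_lift.
  apply: le_trans (wi _ _ Lg gp); apply: le_esum => h /= hg.
  (* The lift of the translated point and the translate of the lift may differ, but they have the
     same image in [Y], so [w] does not distinguish them. *)
  rewrite lee_fin (@w_quot_pt i _ (quot_lift (quot_act (inv D g) y))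
    (act a (inv D g) (quot_lift y)))//.
    rewrite quot_anchor_lift quot_act_p ?sc_inv//.
    by rewrite rg_mul ?sc_inv.
  by rewrite quot_liftK.
Qed.

Lemma quot_strongly_amenable : reiter R quot_action ->
  strongly_amenable_at_infinity R D.
Proof.
move=> ra; exists Y, quot_anchor, quot_action; split.
- by split; [exact: quot_gspace|exact: (reiter_amenable hD hE quot_gspace)].
- exact: second_countable_quot.
- exact: quot_anchor_proper.
- by move=> x; exists (quot_pt (beta_pt hD (un D x))); exact: quot_sectionK.
- exists (fun x => quot_pt (beta_pt hD (un D x))); split.
    exact: quot_section_continuous.
  exact: quot_sectionK.
Qed.

End factor.

Theorem beta_amenable_strongly_amenable (R : realType) (G X : topologicalType)
    (D : groupoid G X) : lc_groupoid D -> etale D ->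
  beta_amenable R D -> strongly_amenable_at_infinity R D.
Proof.
move=> hD hE [p [a [pr]]]; have pE := beta_rg_unique hD pr.
(* The given anchor is the constructed one, so properness is available; the given action is kept as
   it is. *)
move: a; rewrite pE => a ta [ha ama].
have ra := amenable_reiter hD hE ha (@beta_anchor_proper R _ _ _ hD) ama.
have [q [e [N [qP qcov]]]] := countable_patches (R := R) hD hE.
have [L [cL Lcov]] := countable_compacts hD.
(* A pair [(s, n)] stands for the compact set [L s] and the error [1 / (n + 1)]; these countably
   many requests dominate all others. *)
pose I : countType := (seq nat * nat)%type.
have /choice [w wP] : forall i : I, exists w : set_type (beta R D) -> G -> R,
  [/\ {within crossed_set D (beta_anchor (R := R) hD), continuous (fun yg => w yg.1 yg.2)},
    forall y g, 0 <= w y g,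
    forall y, \esum_(g in [set g | rg D g = beta_anchor (R := R) hD y]) (w y g)%:E = 1%E &
    forall y g, L i.1 g -> rg D g = beta_anchor hD y ->
      (\esum_(h in [set h | rg D h = rg D g])
        `|w (act a (inv D g) y) (mul D (inv D g) h) - w y h|%:E <= (i.2.+1%:R^-1)%:E)%E].
  by move=> i; apply: ra; [exact: cL|rewrite invr_gt0].
have wc i : {within crossed_set D (beta_anchor (R := R) hD), continuous (fun yg => w i yg.1 yg.2)}.
  by case: (wP i).
have w0 i : forall y g, 0 <= w i y g by case: (wP i).
have w1 i : forall y, \esum_(g in [set g | rg D g = beta_anchor (R := R) hD y]) (w i y g)%:E = 1%E.
  by case: (wP i).
apply: (quot_strongly_amenable hE (quot_reiter ha ta qP qcov wc w0 w1 _)).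
move=> K d cK d0.
have [s Ks] := Lcov K cK.
have [n nd] : exists n : nat, (n.+1%:R^-1 : R) <= d.
  (* The truncation of [1 / d], plus one, exceeds [1 / d]. *)
  exists (Num.truncn d^-1); rewrite -[leRHS]invrK lef_pV2 ?posrE ?invr_gt0//.
  by apply: ltW; rewrite truncnS_gt.
exists (s, n) => phi g Kg gp; have [_ _ _ wi] := wP (s, n).
by apply: le_trans (wi phi g (Ks _ Kg) gp) _; rewrite lee_fin.
Qed.

Theorem proposition6p16 (R : realType) (G X : topologicalType)
    (D : groupoid G X) (hD : lc_groupoid D) (hE : etale D) :
  strongly_amenable_at_infinity R D <-> beta_amenable R D.
Proof.
split; first exact: strongly_amenable_beta_amenable.
exact: beta_amenable_strongly_amenable.
Qed.
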